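(* Let $d\ge3$, let $r$ be a $d$-variate tail copula density and let $\mathcal V=(T_j)_{j=1}^{d-1}$, $T_j=(N_j,E_j)$, be a regular vine sequence on $[d]$. For any edge $e=(a_e,b_e;D_e)\in E_2\cup\dots\cup E_{d-1}$, writing $a=a_e$, $b=b_e$, $D=D_e$, and for all $x_{D\cup\{a,b\}}$ such that $r_{D}(x_D)$, $r_{D\cup a}(x_{D\cup a})$ and $r_{D\cup b}(x_{D\cup b})$ lie in $(0,\infty)$, $$R_{a|D\cup b}(x_a\mid x_{D\cup b})=C_{a|b;D}\big(R_{a|D}(x_a|x_D)\,\big|\,R_{b|D}(x_b|x_D);\,x_D\big),$$ $$R_{b|D\cup a}(x_b\mid x_{D\cup a})=C_{b|a;D}\big(R_{b|D}(x_b|x_D)\,\big|\,R_{a|D}(x_a|x_D);\,x_D\big).$$ As a consequence, $r$ is determined uniquely by the bivariate tail copula densities $r_{\{a,b\}}$ for $\{a,b\}\in E_1$ and the bivariate copula densities $c_{a_e,b_e;D_e}(\cdot,\cdot;x_{D_e})$ for $e\in E_2\cup\dots\cup E_{d-1}$ and $x_{D_e}\in(0,\infty)^{D_e}$ (with $0<r_{D_e}(x_{D_e})<\infty$): any two $d$-variate tail copula densities for which all these objects coincide are equal.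
   Context: Notation: $[d]=\{1,\dots,d\}$; $x_J=(x_j)_{j\in J}$; in subscripts $i$ stands for $\{i\}$ and $D\cup a$ for $D\cup\{a\}$. Tail copula densities. A $d$-variate tail copula density is a continuous function $r:(0,\infty)^d\to[0,\infty)$ such that (a) $\int_{(0,\infty)^{d-1}} r(x)\,dx_{[d]\setminus\{j\}}=1$ for every $j\in[d]$ and every $x_j\in(0,\infty)$, and (b) $r(sx)=s^{1-d}r(x)$ for all $s>0$, $x\in(0,\infty)^d$. For non-empty $J\subseteq[d]$ the margin is $r_J(x_J)=\int r(x)\,dx_{[d]\setminus J}\in[0,\infty]$ (so $r_{[d]}=r$ and $r_{\{j\}}\equiv1$). For disjoint non-empty $I,J$ and $x_J$ with $0<r_J(x_J)<\infty$, set $r_{I|J}(x_I|x_J)=r_{I\cup J}(x_{I\cup J})/r_J(x_J)$; for $I=\{i\}$, $R_{i|J}(x_i|x_J)=\int_0^{x_i}r_{i|J}(t|x_J)\,dt$, with quantile function $R^{-1}_{i|J}(u|x_J)=\inf\{y>0:R_{i|J}(y|x_J)\ge u\}$. Regular vines. A tree is a connected acyclic graph $T=(N,E)$, edges being two-element subsets of $N$. A regular vine sequence on $[d]$ is $\mathcal V=(T_1,\dots,T_{d-1})$ where $T_1=(N_1,E_1)$ is a tree with $N_1=[d]$ and, for $j\ge2$, $T_j=(N_j,E_j)$ is a tree with $N_j=E_{j-1}$ such that $|a\cap b|=1$ for every $\{a,b\}\in E_j$. The complete union of an edge $e$ is $A_e=e$ if $e\in E_1$ and $A_e=A_a\cup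 A_b$ if $e=\{a,b\}\in E_j$, $j\ge2$. For $e=\{a,b\}\in E_j$, $j\ge2$, the conditioning set is $D_e=A_a\cap A_b$ and the conditioned set is $\mathcal C_e=(A_a\setminus A_b)\cup(A_b\setminus A_a)$, which has exactly two elements $a_e<b_e$. One writes $e=(a_e,b_e;D_e)$. Pair copulas. For $e=(a,b;D)\in E_2\cup\dots\cup E_{d-1}$ and $x_D$ with $0<r_D(x_D)<\infty$, the pair copula density is, for $u_a,u_b\in(0,1)$, $c_{a,b;D}(u_a,u_b;x_D)=\dfrac{r_{\{a,b\}|D}(x_a,x_b|x_D)}{r_{a|D}(x_a|x_D)\,r_{b|D}(x_b|x_D)}$ with $x_a=R^{-1}_{a|D}(u_a|x_D)$, $x_b=R^{-1}_{b|D}(u_b|x_D)$ (set to $0$ where the denominator is $0$ or a term is infinite), and $C_{a|b;D}(u_a|u_b;x_D)=\int_0^{u_a}c_{a,b;D}(v,u_b;x_D)\,dv$, $C_{b|a;D}(u_b|u_a;x_D)=\int_0^{u_b}c_{a,b;D}(u_a,v;x_D)\,dv$. *)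

(* Defs.v *)
From HB Require Import structures.
From mathcomp Require Import all_boot all_order all_algebra.
From mathcomp Require Import all_classical all_reals all_analysis.

Set Implicit Arguments.
Unset Strict Implicit.
Unset Printing Implicit Defensive.

Import Order.TTheory GRing.Theory Num.Theory.
Import numFieldNormedType.Exports.

Local Open Scope classical_set_scope.
Local Open Scope ring_scope.

Section TailCopulaDensity.
Context {R : realType} {d : nat}.
Implicit Types (r : 'rV[R]_d -> R) (I J D : {set 'I_d}) (x : 'rV[R]_d).

Definition orthant : set 'rV[R]_d := [set x | forall i, 0 < x 0 i].

Definition upd x (k : 'I_d) (t : R) : 'rV[R]_d :=
  \row_i (if i == k then t else x 0 i).

Local Notation mu := (@lebesgue_measure R).

(* A function of x_J is represented as a function of the full vector x that
   ignores the coordinates outside J.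

   The integral over (0,oo)^([d] \ J) is written as an iterated Lebesgue
   integral over the coordinates outside J. For r nonnegative and continuous
   on (0,oo)^d this is, by Tonelli, the integral against the product measure,
   and the order of integration is irrelevant. *)
Definition integrate_out (k : 'I_d) (g : 'rV[R]_d -> \bar R) x : \bar R :=
  (\int[mu]_(t in `]0%R, +oo[) g (upd x k t))%E.

Definition margin r J x : \bar R :=
  foldr integrate_out (fun y => (r y)%:E) (enum (~: J)%SET) x.

(* Only the values of r on the orthant are meaningful. *)
Definition tail_copula_density r : Prop :=
  [/\ {within orthant, continuous r},
      forall x, orthant x -> 0 <= r x,
      forall (j : 'I_d) x, orthant x -> margin r [set j]%SET x = 1%E
    & forall (s : R) x, 0 < s -> orthant x ->
        r (s *: x) = s ^ (1 - d%:Z) * r x].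

Definition cond_density r I J x : \bar R :=
  (margin r (I :|: J)%SET x / margin r J x)%E.

Definition cond_cdf r (i : 'I_d) J (y : R) x : \bar R :=
  (\int[mu]_(t in `]0%R, y]) cond_density r [set i]%SET J (upd x i t))%E.

Definition cond_quantile r (i : 'I_d) J (u : R) x : R :=
  inf [set y : R | 0 < y /\ (u%:E <= cond_cdf r i J y x)%E].

Definition pair_copula_density r (a b : 'I_d) D (ua ub : R) x : R :=
  let y := upd (upd x a (cond_quantile r a D ua x))
                      b (cond_quantile r b D ub x) in
  let rab := cond_density r [set a; b]%SET D y in
  let ra := cond_density r [set a]%SET D y in
  let rb := cond_density r [set b]%SET D y in
  if [&& rab \is a fin_num, ra \is a fin_num, rb \is a fin_num
       & (ra * rb != 0)%E]
  then fine rab / (fine ra * fine rb) else 0.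

(* C_{a|b;D}(ua | ub; x_D) *)
Definition pair_cond_cdf_l r (a b : 'I_d) D (ua ub : R) x : \bar R :=
  (\int[mu]_(v in `]0%R, ua]) (pair_copula_density r a b D v ub x)%:E)%E.

(* C_{b|a;D}(ub | ua; x_D) *)
Definition pair_cond_cdf_r r (a b : 'I_d) D (ub ua : R) x : \bar R :=
  (\int[mu]_(v in `]0%R, ub]) (pair_copula_density r a b D ua v x)%:E)%E.

End TailCopulaDensity.

Section Trees.
Context {T : finType}.
Implicit Types (N : {set T}) (E : {set {set T}}).

Definition adjacent E : rel T := [rel x y | [set x; y]%SET \in E].

Definition is_tree N E : Prop :=
  [/\ forall e : {set T}, e \in E -> e \subset N /\ #|e| = 2%N,
      {in N &, forall x y, connect (adjacent E) x y}
    & forall p : seq T, ucycle (adjacent E) p -> (size p <= 2)%N].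

End Trees.

(* The tree T_{j+1} has its nodes in [vnode d j]: an edge of one tree is a set
   of nodes, which is a node of the next tree. *)
Fixpoint vnode (d j : nat) : finType :=
  if j is j'.+1 then {set vnode d j'} : finType else 'I_d.

(* [V j] is the edge set of T_{j+1}; only the indices j < d - 1 matter. *)
Definition vine_edges (d : nat) : Type := forall j : nat, {set {set vnode d j}}.

Definition vine_nodes d (V : vine_edges d) (j : nat) : {set vnode d j} :=
  match j with
  | 0 => [set: vnode d 0]%SET
  | j'.+1 => V j'
  end.

Definition regular_vine d (V : vine_edges d) : Prop :=
  (forall j, (j < d.-1)%N -> is_tree (vine_nodes V j) (V j)) /\
  (forall j, (j.+1 < d.-1)%N -> forall a b : {set vnode d j},
     [set a; b]%SET \in V j.+1 -> #|(a :&: b)%SET| = 1%N).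

Fixpoint complete_union (d j : nat) : {set vnode d j} -> {set 'I_d} :=
  match j with
  | 0 => fun e => e
  | j'.+1 => fun e => (\bigcup_(f in e) complete_union f)%SET
  end.

(* (a, b; D) is (a_e, b_e; D_e) for some edge e = {f, g} of T_{j+2}. *)
Definition is_vine_edge d (V : vine_edges d) (j : nat)
    (a b : 'I_d) (D : {set 'I_d}) : Prop :=
  exists f g : {set vnode d j},
    let Af := complete_union f in
    let Ag := complete_union g in
    [/\ [set f; g]%SET \in V j.+1,
        D = (Af :&: Ag)%SET,
        ((Af :\: Ag) :|: (Ag :\: Af))%SET = [set a; b]%SET
      & (a < b)%N].

(* Main.v *)
(** Margins of a tail copula density may be infinite or discontinuous, but by
    Fatou's lemma they are lower semicontinuous on the orthant. Hence they are
    measurable, Tonelli's theorem makes them independent of the order of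
    integration, and positivity is inherited: if [r_J] vanishes at a point, so
    does every larger margin.

    First part: where [r_(D+a) (x) > 0] the conditional distribution function
    of [x_a] given [x_D] is strictly increasing near [x_a], so the quantile
    transform recovers [x_a]. Substituting [v = R_(a|D) (t | x_D)] in the
    integral of the pair copula density then gives [r_(D+a+b) / r_(D+b)] at
    almost every [t]; the exceptional case [r_(D+a) = 0] is harmless because
    [r_(D+a+b)] vanishes there too.

    Uniqueness: by induction along the vine, the margins on the complete union
    [A_e] of the two densities agree almost everywhere for every edge [e]; only
    almost everywhere, since the pair copula does not see the points where the
    margin on [D+a+b] is infinite. The complete union of the last edge is the
    whole index set, and two continuous functions that agree almost everywhere
    are equal. *)

Require Import Defs.
From HB Require Import structures.
From mathcomp Require Import all_boot all_order all_algebra.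
From mathcomp Require Import all_classical all_reals all_analysis.
From mathcomp Require Import measurable_realfun zify ring.

Set Implicit Arguments.
Unset Strict Implicit.
Unset Printing Implicit Defensive.

Import Order.TTheory GRing.Theory Num.Theory.
Import numFieldNormedType.Exports.

Local Open Scope classical_set_scope.
Local Open Scope ring_scope.

(** * Regular vines *)

Local Notation adjacent := Defs.adjacent.

Section TreeCombinatorics.
Context {T : finType}.
Implicit Types (N X : {set T}) (E F : {set {set T}}).

Lemma adjacent_sym E : symmetric (adjacent E).
Proof. by move=> x y; rewrite /adjacent /= finset.setUC. Qed.

Lemma connect_adjacent_sym E : connect_sym (adjacent E).
Proof. exact: sym_connect_sym (adjacent_sym E). Qed.

Lemma sub_connect_adjacent E F x y : F \subset E ->
  connect (adjacent F) x y -> connect (adjacent E) x y.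
Proof.
move=> FE; apply: connect_sub => u v uv; apply: connect1.
exact: (fintype.subsetP FE).
Qed.

Lemma tree_edge N E (e : {set T}) : is_tree N E -> e \in E ->
  exists p q, [/\ e = [set p; q]%SET, p != q, p \in N & q \in N].
Proof.
move=> [+ _ _] => /[apply] -[eN /eqP/cards2P[p [q [pq eE]]]].
exists p, q; split => //; apply: (fintype.subsetP eN); rewrite eE !inE eqxx//.
by rewrite orbT.
Qed.

(* Otherwise a shortest path in [F] from [p] to [q] closes up to a cycle. *)
Lemma tree_edge_connect N E F p q : is_tree N E -> F \subset E -> p != q ->
  [set p; q]%SET \in E -> connect (adjacent F) p q -> [set p; q]%SET \in F.
Proof.
move=> [_ _ acyc] FE pq pqE /connectP[s sp qE].
have {sp qE} [s' [sp us qE]] : exists s', [/\ path (adjacent F) p s',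
    uniq (p :: s') & q = last p s'].
  by case: (shortenP sp) qE => s' sp' us _ qE; exists s'.
case: s' => [|u [|v s']] in sp us qE.
- by rewrite qE eqxx in pq.
- by move: sp; rewrite /= andbT qE.
have /acyc : ucycle (adjacent E) [:: p, u, v & s'].
  rewrite /ucycle us andbT /cycle rcons_path -qE.
  apply/andP; split; last by rewrite /adjacent /= finset.setUC.
  by apply: sub_path sp => x y; exact: (fintype.subsetP FE).
by [].
Qed.

(** Grow a subtree greedily: while nodes are left outside [X], connectedness gives an edge leaving
    [X], and this edge is new because all edges of [F] lie inside [X]. With [n] equal to [#|N|]
    minus one this bounds the number of edges of a tree from below. *)
Lemma connected_edges_ge N E n : is_tree N E -> (n < #|N|)%N ->
  exists X F, [/\ X \subset N, #|X| = n.+1, F \subset E, #|F| = n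
    & forall e : {set T}, e \in F -> e \subset X].
Proof.
move=> [edge conn _]; elim: n => [|n IH] nN.
  have /card_gt0P[p pN] := nN.
  exists [set p]%SET, finset.set0; split.
  - by rewrite finset.sub1set.
  - by rewrite cards1.
  - exact: finset.sub0set.
  - by rewrite cards0.
  - by move=> e; rewrite inE.
have [X [F [XN cX FE cF FX]]] := IH (ltnW nN).
have [p pX] : exists p, p \in X by apply/card_gt0P; rewrite cX.
have /fintype.subsetPn[q qN qX] : ~~ (N \subset X).
  by apply/negP => /subset_leq_card; rewrite cX leqNgt nN.
(* The first edge that leaves [X] on a path from [p] to [q]. *)
have [u [v [uX vX uvE]]] : exists u v, [/\ u \in X, v \notin X & adjacent E u v].
  have /connectP[s sp qE] := conn _ _ (fintype.subsetP XN _ pX) qN.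
  elim: s p pX sp qE => [|v s IHs] p pX /=; first by move=> _ qp; rewrite qp pX in qX.
  move=> /andP[pv sp] qE; have [vX|vX] := boolP (v \in X); first exact: IHs sp qE.
  by exists p, v.
exists (v |: X)%SET, ([set u; v] |: F)%SET; split.
- apply/fintype.subsetP => w; rewrite !inE => /orP[/eqP ->|]; last exact: (fintype.subsetP XN).
  have [eN _] := edge _ uvE.
  by apply: (fintype.subsetP eN); rewrite !inE eqxx orbT.
- by rewrite cardsU1 vX cX.
- apply/fintype.subsetP => e; rewrite !inE => /orP[/eqP ->//|]; exact: (fintype.subsetP FE).
- rewrite cardsU1 cF; case: (boolP (_ \in F)) => // /FX /fintype.subsetP/(_ v).
  by rewrite !inE eqxx orbT (negPf vX) => /(_ isT).
- move=> e; rewrite !inE => /orP[/eqP ->|/FX eX].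
    apply/fintype.subsetP => w; rewrite !inE => /orP[/eqP ->|->//].
    by rewrite uX orbT.
  by apply: fintype.subset_trans eX _; exact: finset.subsetUr.
Qed.

End TreeCombinatorics.

(** * Sizes of complete unions in a regular vine *)

Section VineCombinatorics.
Context {d : nat} (V : vine_edges d).
Hypothesis hV : regular_vine V.

(* [n] is the number of nodes of [S], which is connected in the tree with
   edges [V m]. *)
Inductive grows (m : nat) : {set vnode d m} -> nat -> Prop :=
| grows1 p : p \in vine_nodes V m -> grows [set p]%SET 1
| growsU S n p q : grows S n -> p \in S -> q \notin S ->
    [set p; q]%SET \in V m -> grows (q |: S)%SET n.+1.

Lemma grows_card m (S : {set vnode d m}) n : grows S n -> #|S| = n.
Proof.
elim=> [p _|{}S {}n p q _ IH _ qS _]; first by rewrite cards1.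
by rewrite cardsU1 qS IH.
Qed.

Lemma grows_nodes m (S : {set vnode d m}) n : (m < d.-1)%N ->
  grows S n -> S \subset vine_nodes V m.
Proof.
move=> md; have [edge _ _] := hV.1 m md.
elim=> [p pN|{}S {}n p q _ IH _ _ pq]; first by rewrite finset.sub1set.
rewrite finset.subUset IH andbT finset.sub1set.
have [eN _] := edge _ pq.
by apply: (fintype.subsetP eN); rewrite !inE eqxx orbT.
Qed.

(* In a tree a connected set of [n] edges spans [n.+1] nodes. *)
Lemma grows_cover m (S : {set vnode d m.+1}) n : (m.+1 < d.-1)%N -> grows S n ->
  grows (finset.cover S) n.+1 /\
  {in finset.cover S &, forall p q, connect (adjacent S) p q}.
Proof.
move=> md; have md' := ltnW md; have tree := hV.1 m md'.
elim=> [f fV|{}S {}n f g gS [IHg IHc] fS gNS fg].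
  have [p [q [fE pq pN qN]]] := tree_edge tree fV.
  rewrite /finset.cover big_set1; split.
    rewrite fE finset.setUC; apply: (growsU (p := p)) => //; last by rewrite -fE.
    - exact: grows1.
    - by rewrite inE.
    - by rewrite inE eq_sym.
  move=> u v; rewrite fE !inE => /orP[] /eqP -> /orP[] /eqP -> //; apply: connect1;
    by rewrite /adjacent /= inE // finset.setUC.
have Snodes := grows_nodes md gS.
have gV : g \in V m.
  have [/(_ _ fg)[eN _] _ _] := hV.1 m.+1 md.
  by apply: (fintype.subsetP eN); rewrite !inE eqxx orbT.
(* By the proximity condition [f] and [g] share exactly one node [p], so adding [g] to [S] can only
   add the other end [q] of [g] to the cover. *)
have /eqP/cards1P[p fgp] := hV.2 m md f g fg.
have [pf pg] : p \in f /\ p \in g.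
  by apply/andP; rewrite -finset.in_setI fgp inE.
have [q [pq gE]] : exists q, p != q /\ g = [set p; q]%SET.
  have [p' [q' [gE pq' _ _]]] := tree_edge tree gV.
  move: pg; rewrite gE !inE => /orP[] /eqP pE.
    by exists q'; rewrite pE.
  by exists p'; rewrite pE eq_sym finset.setUC.
have pS : p \in finset.cover S by apply/bigcupP; exists f.
have coverE : finset.cover (g |: S)%SET = (q |: finset.cover S)%SET.
  rewrite /finset.cover finset.bigcup_setU big_set1 -/(finset.cover S) gE.
  have /finset.setUidPr pE : [set p]%SET \subset finset.cover S by rewrite finset.sub1set.
  by rewrite -finset.setUA finset.setUCA pE.
(* If [q] were already covered, [S] would connect [p] to [q], and acyclicity of the lower tree would
   force [g] into [S]. *)
have qS : q \notin finset.cover S.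
  apply/negP => qS; move: gNS; rewrite gE.
  by rewrite (tree_edge_connect tree Snodes pq) -?gE// IHc.
split.
  rewrite coverE; apply: growsU IHg pS qS _.
  by rewrite -gE.
rewrite coverE.
have sub u v : connect (adjacent S) u v -> connect (adjacent (g |: S)%SET) u v.
  by apply: sub_connect_adjacent; exact: finset.subsetUr.
have pqc : connect (adjacent (g |: S)%SET) p q.
  by apply: connect1; rewrite /adjacent /= -gE !inE eqxx.
have toP u : u \in (q |: finset.cover S)%SET -> connect (adjacent (g |: S)%SET) p u.
  by rewrite !inE => /orP[/eqP ->//|uS]; apply: sub; exact: IHc.
move=> u v /toP pu /toP; apply: connect_trans.
by rewrite connect_adjacent_sym.
Qed.

(** Flattening one level leaves the complete union unchanged; this moves a cardinality count from
    one tree of the vine down to the previous one. *)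
Lemma complete_union_cover m (S : {set vnode d m.+1}) :
  complete_union (j := m.+1) S = complete_union (finset.cover S).
Proof.
case: m S => [|m] S //=.
apply/finset.setP => i; apply/bigcupP/bigcupP => [[f fS /bigcupP[h hf ih]]|[h]].
  by exists h => //; apply/bigcupP; exists f.
move=> /bigcupP[f fS hf] ih; exists f => //; apply/bigcupP.
by exists h.
Qed.

(** Each descent by one tree replaces a connected set by its cover, which has one more node. After
    [m] descents the nodes are elements of ['I_d]. *)
Lemma card_complete_union_grows m (S : {set vnode d m}) n : (m < d.-1)%N ->
  grows S n -> #|complete_union S| = (n + m)%N.
Proof.
elim: m S n => [|m IH] S n md gS; first by rewrite addn0; exact: grows_card gS.
rewrite complete_union_cover (IH _ n.+1) ?addSnnS//; first exact: ltnW.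
exact: (grows_cover md gS).1.
Qed.

(** An edge is a connected set of two nodes. *)
Lemma card_complete_union m (e : {set vnode d m}) : (m < d.-1)%N ->
  e \in V m -> #|complete_union e| = m.+2.
Proof.
move=> md eV; have [p [q [eE pq pN _]]] := tree_edge (hV.1 m md) eV.
rewrite (@card_complete_union_grows _ _ 2)//.
rewrite eE finset.setUC; apply: (growsU (p := p)) => //.
- exact: grows1.
- by rewrite inE.
- by rewrite inE eq_sym.
- by rewrite -eE.
Qed.

(** The edges of a tree are the nodes of the next one, and they are at most one fewer than its
    nodes; so each level loses at most one node. *)
Lemma card_vine_nodes m : (m < d.-1)%N -> (d <= #|vine_nodes V m| + m)%N.
Proof.
elim: m => [|m IH] md; first by rewrite /= cardsT card_ord addn0.
have dN := IH (ltnW md).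
have N0 : (0 < #|vine_nodes V m|)%N.
  by rewrite lt0n; apply/eqP => N0; rewrite N0 in dN; lia.
have [X [F [_ _ FE cF _]]] := connected_edges_ge (hV.1 m (ltnW md))
  (ltac:(by rewrite prednK) : (#|vine_nodes V m|.-1 < #|vine_nodes V m|)%N).
have := subset_leq_card FE; rewrite cF /= => FV.
by rewrite addnS -addSn (leq_trans dN)// leq_add2r -[X in (X <= _)%N]prednK.
Qed.

Lemma top_edge : (1 < d)%N -> exists e : {set vnode d d.-2}, e \in V d.-2.
Proof.
move=> d1; have md : (d.-2 < d.-1)%N by case: (d) d1 => [|[|]].
have tree := hV.1 _ md; have dN := card_vine_nodes md.
have N1 : (1 < #|vine_nodes V d.-2|)%N.
  by lia.
have [X [F [_ _ FE cF _]]] := connected_edges_ge tree N1.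
have /card_gt0P[e eF] : (0 < #|F|)%N by rewrite cF.
by exists e; exact: (fintype.subsetP FE).
Qed.

(* [e = {f, g}] satisfies |A_f| = |A_g| = m+2 and |A_f :|: A_g| = m+3. *)
Lemma vine_edge_split m (e : {set vnode d m.+1}) : (m.+1 < d.-1)%N ->
  e \in V m.+1 -> exists (f g : {set vnode d m}) (a b : 'I_d) (D : {set 'I_d}),
    [/\ e = [set f; g]%SET /\ f \in V m /\ g \in V m,
        complete_union f = (a |: D)%SET,
        complete_union g = (b |: D)%SET,
        complete_union e = (a |: (b |: D))%SET
      & [/\ is_vine_edge V m a b D, a \notin D, b \notin D, a != b
          & D != finset.set0]].
Proof.
move=> md eV; have [f [g [eE fg fV gV]]] := tree_edge (hV.1 _ md) eV.
have cf := card_complete_union (ltnW md) fV.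
have cg := card_complete_union (ltnW md) gV.
have := card_complete_union md eV.
have AeE : complete_union e = (complete_union f :|: complete_union g)%SET.
  by rewrite /= eE finset.bigcup_setU !big_set1.
set Af := complete_union f in cf AeE; set Ag := complete_union g in cg AeE.
rewrite AeE cardsU cf cg => cU.
set D := (Af :&: Ag)%SET.
have cD : #|D| = m.+1.
  have : (#|D| <= m.+2)%N by rewrite -cf subset_leq_card// finset.subsetIl.
  by rewrite -/D in cU; move: cU; lia.
have /eqP/cards1P[a fa] : #|(Af :\: Ag)%SET| = 1%N.
  by rewrite cardsD -/D cf cD subSnn.
have /eqP/cards1P[b gb] : #|(Ag :\: Af)%SET| = 1%N.
  by rewrite cardsD finset.setIC -/D cg cD subSnn.
have AfE : Af = (a |: D)%SET by rewrite -fa finset.setUC finset.setID.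
have AgE : Ag = (b |: D)%SET by rewrite -gb /D finset.setIC finset.setUC finset.setID.
have [aAf aAg] : a \in Af /\ a \notin Ag.
  by apply/andP; rewrite andbC -finset.in_setD fa inE.
have [bAg bAf] : b \in Ag /\ b \notin Af.
  by apply/andP; rewrite andbC -finset.in_setD gb inE.
have aD : a \notin D by rewrite inE (negPf aAg) andbF.
have bD : b \notin D by rewrite inE (negPf bAf).
have ab : a != b by apply: contraNneq bAf => <-.
have D0 : D != finset.set0 by rewrite -card_gt0 cD.
(* [is_vine_edge] requires [a < b], so the roles of [f] and [g] are exchanged when the order is the
   opposite one. *)
have [altb|blta|/val_inj abE] := ltngtP a b.
- exists f, g, a, b, D; split => //.
    by rewrite AfE AgE -finset.setUUl finset.setUA.
  split => //; exists f, g; split => //; first by rewrite -eE.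
  by rewrite -/Af -/Ag fa gb.
- exists g, f, b, a, D; split => //; first by rewrite eE finset.setUC.
    by rewrite AfE AgE finset.setUC -finset.setUUl finset.setUA.
  split => //; last by rewrite eq_sym.
  exists g, f; split => //; first by rewrite finset.setUC -eE.
    by rewrite -/Af -/Ag finset.setIC.
  by rewrite -/Af -/Ag fa gb.
- by rewrite abE eqxx in ab.
Qed.

End VineCombinatorics.

(** * Iterated integrals over the orthant *)

Section RowVectors.
Context {R : realType} {d : nat}.
Implicit Types (x y : 'rV[R]_d) (g : 'rV[R]_d -> \bar R).
Local Notation mu := (@lebesgue_measure R).

Lemma upd_same x k (t : R) : upd x k t 0 k = t.
Proof. by rewrite mxE eqxx. Qed.

Lemma upd_neq x k (t : R) i : i != k -> upd x k t 0 i = x 0 i.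
Proof. by rewrite mxE => /negPf ->. Qed.

Lemma upd_id x k : upd x k (x 0 k) = x.
Proof. by apply/rowP => i; rewrite mxE; case: eqP => // ->. Qed.

Lemma upd_upd x k (s t : R) : upd (upd x k s) k t = upd x k t.
Proof. by apply/rowP => i; rewrite !mxE; case: eqP. Qed.

Lemma updC x k l (s t : R) : k != l ->
  upd (upd x k s) l t = upd (upd x l t) k s.
Proof.
move=> kl; apply/rowP => i; rewrite !mxE.
by case: eqP => [->|//]; rewrite eq_sym (negPf kl).
Qed.

Lemma orthant_upd x k (t : R) : orthant x -> 0 < t -> orthant (upd x k t).
Proof. by move=> x0 t0 i; rewrite mxE; case: eqP. Qed.

Lemma near_upd x k (t : R) (P : set 'rV[R]_d) : nbhs (upd x k t) P ->
  \forall y \near x, P (upd y k t).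
Proof.
move=> /nbhs_ballP[e /= e0 eP]; apply/nbhs_ballP; exists e => //= y [_ xy].
apply: eP; split=> // i j; rewrite !mxE.
by case: eqP => _; [exact: ballxx|exact: xy].
Qed.

Lemma near_upd_coord x k (P : set 'rV[R]_d) : nbhs x P ->
  \forall t \near x 0 k, P (upd x k t).
Proof.
move=> /nbhs_ballP[e /= e0 eP]; apply/nbhs_ballP; exists e => //= t xt.
apply: eP; split=> // i j; rewrite mxE ord1.
by case: eqP => [->|_] //; exact: ballxx.
Qed.

(** Topology is taken on row vectors and the product sigma-algebra on tuples; a function of a row
    vector counts as measurable when its composite with [vec] is. *)
Let T : measurableType _ := d.-tuple (measurableTypeR R).

Definition vec (t : T) : 'rV[R]_d := \row_i tnth t i.

Definition unvec x : T := [tuple x 0 i | i < d].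

Lemma unvecK : cancel unvec vec.
Proof. by move=> x; apply/rowP => i; rewrite mxE tnth_mktuple. Qed.

Definition vmeasurable g := @measurable_fun _ _ T _ setT (g \o vec).

Lemma vmeasurable_comp d' (S : measurableType d') (f : S -> 'rV[R]_d) g :
  (forall i, @measurable_fun _ _ S (measurableTypeR R) setT (fun s => f s 0 i)) ->
  vmeasurable g -> measurable_fun setT (g \o f).
Proof.
move=> mf mg; rewrite (_ : g \o f = (g \o vec) \o (unvec \o f)); last first.
  by apply/funext => s; rewrite /= unvecK.
apply: measurableT_comp => //; apply/measurable_fun_tnthP => i /=.
apply: eq_measurable_fun (mf i) => s _ /=.
by rewrite tnth_mktuple.
Qed.

Lemma measurable_vec_coord i :
  @measurable_fun _ _ T (measurableTypeR R) setT (fun t => vec t 0 i).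
Proof.
apply: eq_measurable_fun (measurable_tnth i) => t _.
by rewrite mxE.
Qed.

Lemma measurable_upd_coord d' (S : measurableType d') (f : S -> 'rV[R]_d)
    (h : S -> R) k i :
  (forall i, @measurable_fun _ _ S (measurableTypeR R) setT (fun s => f s 0 i)) ->
  @measurable_fun _ _ S (measurableTypeR R) setT h ->
  @measurable_fun _ _ S (measurableTypeR R) setT (fun s => upd (f s) k (h s) 0 i).
Proof.
move=> mf mh; have [->|ik] := eqVneq i k.
  by apply: eq_measurable_fun mh => s _; rewrite upd_same.
by apply: eq_measurable_fun (mf i) => s _; rewrite upd_neq.
Qed.

Lemma measurable_upd g x k : vmeasurable g ->
  measurable_fun setT (fun t : R => g (upd x k t)).
Proof.
move=> mg; apply: (@vmeasurable_comp _ (measurableTypeR R) (fun t => upd x k t)) => // i.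
by apply: measurable_upd_coord => // j; exact: measurable_cst.
Qed.

Lemma measurable_upd2 g x k l : vmeasurable g ->
  measurable_fun setT (fun z : R * R => g (upd (upd x k z.1) l z.2)).
Proof.
move=> mg.
apply: (@vmeasurable_comp _ (measurableTypeR R * measurableTypeR R)%type
  (fun z => upd (upd x k z.1) l z.2)) => // i.
apply: measurable_upd_coord => // j.
by apply: measurable_upd_coord => // j'; exact: measurable_cst.
Qed.

(** An open set is the union of the boxes with rational centre and radius [1/(n+1)] that it
    contains. There are countably many; the boxes not contained in [U] are replaced by [set0]. *)
Lemma open_vmeasurable (U : set 'rV[R]_d) : open U ->
  @measurable _ T (vec @^-1` U).
Proof.
move=> oU.
pose B (p : 'rV[rat]_d * nat) : set 'rV[R]_d :=
  [set x | forall i, `|ratr (p.1 0 i) - x 0 i| < p.2.+1%:R^-1].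
have -> : vec @^-1` U = \bigcup_p (if `[< B p `<=` U >] then vec @^-1` B p else set0).
  apply/seteqP; split => [t /= Ut|t [p _]]; last by case: asboolP => // + Bt; exact.
  have /nbhs_ballP[e /= e0 eU] := open_nbhs_nbhs (conj oU Ut).
  (* A box of radius below [e / 2] that contains [vec t] lies in the ball of radius [e] around
     [vec t]. *)
  have [n ne] : exists n, n.+1%:R^-1 < e / 2 :> R.
    have [n _ /(_ _ (leqnn n)) ?] := near_infty_natSinv_lt (PosNum (divr_gt0 e0 (ltr0n _ 2))).
    by exists n.
  have /choice[q qP] : forall i : 'I_d, exists q : rat, `|ratr q - vec t 0 i| < n.+1%:R^-1.
    move=> i; have n0 : (0 : R) < n.+1%:R^-1 by rewrite invr_gt0 ltr0n.
    have [|q] := @rat_in_itvoo R (vec t 0 i - n.+1%:R^-1) (vec t 0 i + n.+1%:R^-1).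
      by rewrite ltrD2l gtrN.
    by rewrite in_itv /= => qn; exists q; rewrite ltr_distl.
  have Bt : B (\row_i q i, n) (vec t) by move=> i; rewrite mxE.
  exists (\row_i q i, n) => //; case: asboolP => //; case => y By.
  apply: eU; split=> // i j; rewrite ord1 /ball /=.
  have := Bt j; have := By j.
  rewrite /= => h1 h2; rewrite [X in `|X|](_ : _ =
    (vec t 0 j - ratr ((\row_i q i) 0 j)) + (ratr ((\row_i q i) 0 j) - y 0 j)); last first.
    by rewrite addrA subrK.
  rewrite (le_lt_trans (ler_normD _ _))// (splitr e) ltrD//; last exact: lt_trans ne.
  by rewrite distrC; exact: lt_trans ne.
apply: countable_bigcupT_measurable => [|p]; first exact: countableP.
case: ifP => // _.
rewrite (_ : _ @^-1` _ = \bigcap_(i in [set: 'I_d])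
   ((fun t : T => vec t 0 i) @^-1` ball (ratr (p.1 0 i) : R) p.2.+1%:R^-1)); last first.
  by apply/seteqP; split => [t tB i _|t tB i]; [exact: tB|exact: (tB i I)].
apply: fin_bigcap_measurable => [|i _]; first exact: finite_finset.
rewrite -[X in measurable X]setTI; apply: measurable_vec_coord => //.
exact: measurable_ball.
Qed.

Lemma lower_semicontinuous_vmeasurable g :
  lower_semicontinuous g -> vmeasurable g.
Proof.
move=> scif; apply: (measurability _ (measurable_realfun.ErealGenOInfty.measurableE R)).
move=> /= _ [_ [a ->]] <-; apply: measurableI => //.
rewrite comp_preimage; apply: open_vmeasurable.
by rewrite preimage_itvoy; move/lower_semicontinuousP : scif; exact.
Qed.

Lemma integrate_out_ge0 k g x : (forall y, (0 <= g y)%E) ->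
  (0 <= integrate_out k g x)%E.
Proof. by move=> g0; apply: integral_ge0. Qed.

(** The measurability part of Tonelli's theorem on the product of [T] with the line, for the
    integrand cut off to positive values of the integration variable. *)
Lemma vmeasurable_integrate_out k g : (forall y, (0 <= g y)%E) ->
  vmeasurable g -> vmeasurable (integrate_out k g).
Proof.
move=> g0 mg.
pose D : set R := `]0, +oo[%classic.
pose f : T * measurableTypeR R -> \bar R :=
  (fun z => g (upd (vec z.1) k z.2)) \_ (snd @^-1` D).
have mD : measurable (snd @^-1` D : set (T * measurableTypeR R)).
  by rewrite -[X in measurable X]setTI; apply: measurable_snd => //; exact: measurable_itv.
have mf : measurable_fun setT f.
  apply: (measurable_restrictT _ mD).1; apply: measurable_funTS.
  apply: (@vmeasurable_comp _ (T * measurableTypeR R)%type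
    (fun z => upd (vec z.1) k z.2)) => // i.
  apply: measurable_upd_coord => // j.
  by apply: (measurableT_comp (measurable_vec_coord j)).
have f0 z : (0 <= f z)%E by apply: erestrict_ge0.
apply: eq_measurable_fun (measurable_fun_fubini_tonelli_F (m2 := mu) _ mf f0).
move=> t _; rewrite /= /integrate_out /fubini_F [RHS]integral_mkcond.
by apply: eq_integral => s _; rewrite /f !patchE /= !mem_setE.
Qed.

(** Tonelli's theorem in the two coordinates [k] and [l]; cutting the integrand off outside the
    quadrant turns both integrals into integrals over the whole line. *)
Lemma integrate_outC k l g x : (forall y, (0 <= g y)%E) -> vmeasurable g ->
  integrate_out k (integrate_out l g) x = integrate_out l (integrate_out k g) x.
Proof.
move=> g0 mg; have [->//|kl] := eqVneq k l.
pose D : set R := `]0, +oo[%classic.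
pose f : measurableTypeR R * measurableTypeR R -> \bar R :=
  (fun z => g (upd (upd x k z.1) l z.2)) \_ (D `*` D).
have mf : measurable_fun setT f.
  apply: (measurable_restrictT _ (measurableX (measurable_itv _) (measurable_itv _))).1.
  by apply: measurable_funTS; exact: measurable_upd2.
have f0 z : (0 <= f z)%E by apply: erestrict_ge0.
have fub := fubini_tonelli (m1 := mu) (m2 := mu) _ mf f0.
have fE s t : f (s, t) = if (s \in D) && (t \in D)
    then g (upd (upd x k s) l t) else 0%E.
  by rewrite /f patchE in_setX.
rewrite /integrate_out [LHS]integral_mkcond [RHS]integral_mkcond.
transitivity (\int[mu]_s \int[mu]_t f (s, t))%E.
  apply: eq_integral => s _; rewrite patchE /=.
  case: ifPn => sD; last first.
    by apply/esym; apply: integral0_eq => t _; rewrite fE (negPf sD).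
  rewrite integral_mkcond; apply: eq_integral => t _.
  by rewrite fE sD patchE.
rewrite fub; apply: eq_integral => t _; rewrite patchE /=.
case: ifPn => tD; last first.
  by apply: integral0_eq => s _; rewrite fE (negPf tD) andbF.
rewrite [RHS]integral_mkcond; apply: eq_integral => s _.
by rewrite fE tD andbT patchE updC.
Qed.

Lemma foldr_integrate_out_ge0 s g : (forall y, (0 <= g y)%E) ->
  forall x, (0 <= foldr integrate_out g s x)%E.
Proof. by move=> g0; elim: s => //= k s IH x; exact: integrate_out_ge0. Qed.

Lemma vmeasurable_foldr s g : (forall y, (0 <= g y)%E) -> vmeasurable g ->
  vmeasurable (foldr integrate_out g s).
Proof.
move=> g0 mg; elim: s => //= k s IH; apply: vmeasurable_integrate_out => //.
exact: foldr_integrate_out_ge0.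
Qed.

Lemma foldr_integrate_out_perm s1 s2 g : (forall y, (0 <= g y)%E) ->
  vmeasurable g -> perm_eq s1 s2 ->
  foldr integrate_out g s1 = foldr integrate_out g s2.
Proof.
move=> g0 mg.
(* Commuting [k] past the entries of [u] one at a time brings it to the front. *)
have rot k u v : foldr integrate_out g (u ++ k :: v) =
    foldr integrate_out g (k :: u ++ v).
  elim: u => //= l u ->; apply/funext => x /=; apply: integrate_outC.
    exact: foldr_integrate_out_ge0.
  exact: vmeasurable_foldr.
elim: s1 s2 => [|k s1 IH] s2; first by rewrite perm_sym => /perm_nilP ->.
move=> /[dup] /perm_mem/(_ k); rewrite mem_head => /esym.
case/splitPr => u v; rewrite perm_sym -cat1s perm_catCA /= perm_cons => p.
by rewrite rot /= (IH (u ++ v))// perm_sym.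
Qed.

Lemma foldr_integrate_out_agree s g x y :
  (forall i, i \notin s -> x 0 i = y 0 i) ->
  foldr integrate_out g s x = foldr integrate_out g s y.
Proof.
elim: s x y => [|k s IH] x y xy /=.
  by congr (g _); apply/rowP => i; exact: xy.
apply: eq_integral => t _; apply: IH => i si; rewrite !mxE.
by case: eqP => // ik; apply: xy; rewrite inE negb_or si andbT; exact/eqP.
Qed.

End RowVectors.

(** * Lower semicontinuity and Fatou's lemma *)

Section LowerSemicontinuity.
Context {R : realType}.

(** The sequential form of lower semicontinuity, as needed for Fatou's lemma: every real level below
    [g x] is eventually below [g (u n)], so no real number separates the limit inferior from a
    larger [g x]. *)
Lemma lower_semicontinuous_le_limn_einf (X : topologicalType) (g : X -> \bar R)
    (u : nat -> X) (x : X) : lower_semicontinuous g -> u @ \oo --> x ->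
  (g x <= limn_einf (g \o u))%E.
Proof.
move=> lg ux.
have lim_ge a : (a%:E < g x)%E -> (a%:E <= limn_einf (g \o u))%E.
  move=> /lg[V xV Vg]; rewrite limn_einf_lim.
  have [N _ NV] : \forall n \near \oo, V (u n) by exact: ux.
  apply: lime_ge; first exact: is_cvg_einfs.
  exists N => // n /= Nn; apply: le_ereal_inf_tmp => _ [m /= nm <-].
  by apply/ltW/Vg/NV => /=; exact: leq_trans nm.
rewrite leNgt; apply/negP => Lg.
have [a La ag] : exists2 a : R, (limn_einf (g \o u) < a%:E)%E & (a%:E < g x)%E.
  move: Lg; case: (limn_einf _) => [l| |]; case: (g x) => [b| |] //=.
  - rewrite lte_fin => lb; exists ((l + b) / 2); rewrite lte_fin.
      by rewrite (midf_lt lb).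
    by rewrite (midf_lt lb).
  - by move=> _; exists (l + 1); rewrite ?ltry// lte_fin ltrDl.
  - by move=> _; exists (b - 1); rewrite ?ltNyr// lte_fin gtrBl.
  - by move=> _; exists 0; rewrite ?ltry ?ltNyr.
by have := lim_ge _ ag; rewrite leNgt La.
Qed.

Lemma measurable_fun_limn_einf d (T : measurableType d) (D : set T)
    (f : (T -> \bar R)^nat) : (forall n, measurable_fun D (f n)) ->
  measurable_fun D (fun x => limn_einf (f ^~ x)).
Proof.
move=> mf; apply: (eq_measurable_fun (fun x => - limn_esup (fun n => - f n x))%E).
  by move=> x _; rewrite (limn_esupN (f ^~ x)) oppeK.
apply: measurableT_comp => //; apply: measurable_fun_limn_esup => n.
exact: measurableT_comp.
Qed.

End LowerSemicontinuity.

Section LowerSemicontinuousIntegrals.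
Context {R : realType} {d : nat}.
Implicit Types (x y : 'rV[R]_d) (g : 'rV[R]_d -> \bar R).
Local Notation mu := (@lebesgue_measure R).

(** If the integral exceeded [a] at [x] but near no neighbourhood of [x], there would be points
    [u n] tending to [x] with integral at most [a]. Lower semicontinuity of [g] in each slice and
    Fatou's lemma then bound the integral at [x] by [a]. *)
Lemma lower_semicontinuous_integrate_out k g : (forall y, (0 <= g y)%E) ->
  lower_semicontinuous g -> lower_semicontinuous (integrate_out k g).
Proof.
move=> g0 lg x a; have mg := lower_semicontinuous_vmeasurable lg.
apply: contraPP => noV.
have /choice[u uP] : forall n : nat, exists y,
    ball x n.+1%:R^-1 y /\ (integrate_out k g y <= a%:E)%E.
  move=> n; apply: contrapT => /forallNP nV; apply: noV.
  exists (ball x n.+1%:R^-1); first by apply: nbhsx_ballx; rewrite invr_gt0.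
  by move=> y xy; rewrite ltNge; apply/negP => ya; exact: (nV y).
have ux : u @ \oo --> x.
  move=> V /nbhs_ballP[e /= e0 eV].
  have [N _ Ne] := near_infty_natSinv_lt (PosNum e0).
  exists N => // n /= Nn; apply: eV; apply: le_ball (uP n).1.
  exact/ltW/Ne.
apply/negP; rewrite -leNgt /integrate_out.
apply: (@le_trans _ _ (\int[mu]_(t in `]0%R, +oo[)
    limn_einf (fun n => g (upd (u n) k t)))%E).
  apply: ge0_le_integral => //.
  - by apply: measurable_funTS; exact: measurable_upd.
  - apply: measurable_fun_limn_einf => n.
    by apply: measurable_funTS; exact: measurable_upd.
  - move=> t _; apply: lower_semicontinuous_le_limn_einf => // V xV.
    exact: (ux _ (near_upd xV)).
apply: le_trans (fatou mu _ _ _) _ => //.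
- by move=> n; apply: measurable_funTS; exact: measurable_upd.
rewrite limn_einf_lim; apply: lime_le; first exact: is_cvg_einfs.
apply: nearW => n; apply: ge_ereal_inf; exists (integrate_out k g (u n)).
  by exists n => /=.
exact: (uP n).2.
Qed.

Lemma lower_semicontinuous_foldr s g : (forall y, (0 <= g y)%E) ->
  lower_semicontinuous g -> lower_semicontinuous (foldr integrate_out g s).
Proof.
move=> g0 lg; elim: s => //= k s IH.
by apply: lower_semicontinuous_integrate_out => //; exact: foldr_integrate_out_ge0.
Qed.

(** A vanishing integral makes [f] zero almost everywhere on [D], whereas [f] is positive on a ball,
    which has positive measure. *)
Lemma integral_gt0_near (D : set R) (f : R -> \bar R) (t : R) :
  measurable D -> measurable_fun D f -> (forall s, D s -> (0 <= f s)%E) ->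
  (\forall s \near t, D s /\ (0 < f s)%E) ->
  (0 < \int[mu]_(s in D) f s)%E.
Proof.
move=> mD mf f0 /nbhs_ballP[e /= e0 eP].
rewrite lt_def integral_ge0 ?andbT//; apply/eqP => If0.
have [_ Df] := ae_eq_integral_abs mu mD mf.
have If : (\int[mu]_(s in D) `|f s| = 0)%E.
  by rewrite -If0; apply: eq_integral => s /set_mem Ds; rewrite gee0_abs// f0.
have [N [mN N0 DN]] := (ae_eq_integral_abs mu mD mf).1 If.
have : (mu (ball t e) <= mu N)%E.
  apply: le_measure; rewrite ?inE//; first exact: measurable_ball.
  move=> s /eP[Ds fs]; apply: DN => /= /(_ Ds) fs0.
  by rewrite fs0 ltxx in fs.
by rewrite N0 (lebesgue_measure_ball t (ltW e0)) leNgt lte_fin mulrn_wgt0.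
Qed.

(** Lower semicontinuity spreads positivity at [x] to an interval of the coordinate [k]. *)
Lemma integrate_out_gt0 k g x : (forall y, (0 <= g y)%E) ->
  lower_semicontinuous g -> 0 < x 0 k -> (0 < g x)%E ->
  (0 < integrate_out k g x)%E.
Proof.
move=> g0 lg xk gx; have mg := lower_semicontinuous_vmeasurable lg.
apply: (@integral_gt0_near _ _ (x 0 k)) => //.
  by apply: measurable_funTS; exact: measurable_upd.
have [V xV Vg] := lg x 0 gx.
near=> s; split.
  by rewrite /= in_itv /= andbT; near: s; exact: lt_nbhsr.
by apply: Vg; near: s; exact: near_upd_coord.
Unshelve. all: by end_near. Qed.

Lemma foldr_integrate_out_gt0 s g x : (forall y, (0 <= g y)%E) ->
  lower_semicontinuous g -> orthant x -> (0 < g x)%E ->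
  (0 < foldr integrate_out g s x)%E.
Proof.
move=> g0 lg x0 gx; elim: s => //= k s IH.
apply: integrate_out_gt0 => //; first exact: foldr_integrate_out_ge0.
exact: lower_semicontinuous_foldr.
Qed.

End LowerSemicontinuousIntegrals.

(** * Margins as lower semicontinuous functions *)

Section Margins.
Context {R : realType} {d : nat}.
Implicit Types (x y : 'rV[R]_d) (J : {set 'I_d}).
Local Notation mu := (@lebesgue_measure R).

Lemma near_orthant x : orthant x -> \forall y \near x, orthant y.
Proof.
move=> x0; apply: (@filter_forall _ _ (fun i y => 0 < y 0 i) _ (nbhs_filter x)) => i.
by have cx := @coord_continuous R 1 d 0 i x; exact: (cvgr_gt _ cx _ (x0 i)).
Qed.

Lemma open_orthant : open (@orthant R d).
Proof. by rewrite openE => x /= x0; exact: near_orthant. Qed.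

(** Off the orthant the values of [r] are arbitrary. Since the orthant is open, extending a
    nonnegative continuous function by zero keeps it lower semicontinuous on the whole space. *)
Definition ext0 (r : 'rV[R]_d -> R) x : \bar R :=
  if `[< orthant x >] then (r x)%:E else 0%E.

Lemma ext0_orthant r x : orthant x -> ext0 r x = (r x)%:E.
Proof. by rewrite /ext0; case: asboolP. Qed.

Section Nonnegative.
Variable r : 'rV[R]_d -> R.
Hypotheses (rc : {within orthant, continuous r}) (r0 : forall x, orthant x -> 0 <= r x).

Lemma ext0_ge0 x : (0 <= ext0 r x)%E.
Proof. by rewrite /ext0; case: asboolP => // /r0; rewrite lee_fin. Qed.

Lemma lower_semicontinuous_ext0 : lower_semicontinuous (ext0 r).
Proof.
move=> x a; rewrite {1}/ext0; case: asboolP => [x0|_] ax; last first.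
  by exists setT => [|y _]; [exact: filterT|exact: lt_le_trans ax (ext0_ge0 y)].
have rx : {for x, continuous r}.
  move: rc; rewrite continuous_open_subspace; last exact: open_orthant.
  by apply; rewrite inE.
rewrite lte_fin in ax; exists [set y | orthant y /\ a < r y] => [|y [y0 ay]]; last first.
  by rewrite ext0_orthant// lte_fin.
by apply: filterI; [exact: near_orthant|exact: (cvgr_gt _ rx _ ax)].
Qed.

End Nonnegative.

Lemma foldr_integrate_out_eq_orthant s (g h : 'rV[R]_d -> \bar R) :
  (forall x, orthant x -> g x = h x) ->
  forall x, orthant x -> foldr integrate_out g s x = foldr integrate_out h s x.
Proof.
move=> gh; elim: s => [|k s IH] x x0 /=; first exact: gh.
apply: eq_integral => t; rewrite inE /= in_itv /= andbT => t0.
by apply: IH; exact: orthant_upd.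
Qed.

(** This agrees with [margin] on the orthant, and for admissible [r] it is nonnegative and lower
    semicontinuous at every point. *)
Definition emargin r J := foldr integrate_out (ext0 r) (enum (~: J)%SET).

Lemma marginE r J x : orthant x -> margin r J x = emargin r J x.
Proof.
by apply: foldr_integrate_out_eq_orthant => y y0; rewrite ext0_orthant.
Qed.

Lemma emargin_agree r J x y : (forall i, i \in J -> x 0 i = y 0 i) ->
  emargin r J x = emargin r J y.
Proof.
move=> xy; apply: foldr_integrate_out_agree => i.
by rewrite mem_enum inE negbK; exact: xy.
Qed.

Lemma emargin_upd r J k t x : k \notin J -> emargin r J (upd x k t) = emargin r J x.
Proof.
move=> kJ; apply: emargin_agree => i iJ; rewrite upd_neq//.
by apply: contraNneq kJ => <-.
Qed.

Section NonnegativeMargins.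
Variable r : 'rV[R]_d -> R.
Hypotheses (rc : {within orthant, continuous r}) (r0 : forall x, orthant x -> 0 <= r x).

Lemma emargin_ge0 J x : (0 <= emargin r J x)%E.
Proof. by apply: foldr_integrate_out_ge0; exact: ext0_ge0. Qed.

Lemma lower_semicontinuous_emargin J : lower_semicontinuous (emargin r J).
Proof.
by apply: lower_semicontinuous_foldr; [exact: ext0_ge0|exact: lower_semicontinuous_ext0].
Qed.

Lemma vmeasurable_emargin J : vmeasurable (emargin r J).
Proof.
by apply: lower_semicontinuous_vmeasurable; exact: lower_semicontinuous_emargin.
Qed.

(** As the order of integration is free, the coordinates of [s] can be integrated last, which starts
    from the margin on the larger set. *)
Lemma emargin_foldr J s : uniq s -> {in s, forall k, k \notin J} ->
  emargin r J = foldr integrate_out (emargin r (J :|: [set k in s])%SET) s.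
Proof.
move=> us sJ; rewrite /emargin -foldr_cat.
apply: foldr_integrate_out_perm; first exact: ext0_ge0.
  by apply: lower_semicontinuous_vmeasurable; exact: lower_semicontinuous_ext0.
apply: uniq_perm; first exact: enum_uniq.
  rewrite cat_uniq us enum_uniq andbT /=; apply/hasPn => k.
  by rewrite mem_enum !inE negb_or => /andP[].
move=> k; rewrite mem_cat !mem_enum !inE negb_or.
by case: (boolP (k \in s)) => [/sJ ->|]; rewrite ?andbT.
Qed.

Lemma emargin_integrate_out J k x : k \notin J ->
  emargin r J x = (\int[mu]_(t in `]0%R, +oo[) emargin r (k |: J)%SET (upd x k t))%E.
Proof.
move=> kJ; rewrite (@emargin_foldr J [:: k])//; last first.
  by move=> i; rewrite inE => /eqP ->.
rewrite /= /integrate_out; apply: eq_integral => t _; congr (emargin r _ _).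
by apply/finset.setP => i; rewrite !inE orbC.
Qed.

Lemma emargin_gt0 J k x : orthant x -> k \notin J ->
  (0 < emargin r (k |: J)%SET x)%E -> (0 < emargin r J x)%E.
Proof.
move=> x0 kJ; rewrite (emargin_integrate_out _ kJ).
apply: integrate_out_gt0 => //; [exact: emargin_ge0|].
exact: lower_semicontinuous_emargin.
Qed.

Lemma emargin_eq0 J k x : orthant x -> k \notin J ->
  emargin r J x = 0%E -> emargin r (k |: J)%SET x = 0%E.
Proof.
move=> x0 kJ J0; apply/eqP; rewrite eq_le emargin_ge0 andbT leNgt.
by apply/negP => /(emargin_gt0 x0 kJ); rewrite J0 ltxx.
Qed.

Lemma measurable_emargin_upd J k x (D : set R) :
  measurable_fun D (fun t => emargin r J (upd x k t)).
Proof. by apply: measurable_funTS; apply: measurable_upd; exact: vmeasurable_emargin. Qed.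

(** An integrable function is finite almost everywhere; here its integral is the smaller margin. *)
Lemma emargin_ae_fin J k x : k \notin J -> (emargin r J x < +oo)%E ->
  {ae mu, forall t, 0 < t -> (emargin r (k |: J)%SET (upd x k t) < +oo)%E}.
Proof.
move=> kJ Jfin.
have [|N [mN N0 DN]] := @integrable_ae _ _ _ mu `]0, +oo[%classic (measurable_itv _)
    (fun t => emargin r (k |: J)%SET (upd x k t)).
  apply/integrableP; split; first exact: measurable_emargin_upd.
  under eq_integral do rewrite gee0_abs ?emargin_ge0//.
  by rewrite -emargin_integrate_out.
exists N; split=> // t tP; apply: DN => /= tfin; apply: tP => /= t0.
by rewrite ltey_eq tfin// in_itv /= t0.
Qed.

End NonnegativeMargins.

End Margins.

(** * Densities and quantile transforms *)

Section Density.
Context d (T : measurableType d) (R : realType).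
Variables (mu : {sigma_finite_measure set T -> \bar R}) (g : T -> \bar R).
Hypotheses (g0 : forall x, (0 <= g x)%E) (ig : mu.-integrable setT g).

Let mg : measurable_fun setT g := measurable_int _ ig.

(* The hypotheses are arguments so that the measure instance can be inferred. *)
Definition density_measure of (forall x, (0 <= g x)%E) & mu.-integrable setT g :=
  fun A : set T => (\int[mu]_(x in A) g x)%E.

Local Notation nu := (density_measure g0 ig).

Let density0 : nu set0 = 0%E. Proof. by rewrite /density_measure integral_set0. Qed.

Let density_ge0 A : (0 <= nu A)%E. Proof. exact: integral_ge0. Qed.

Let density_sigma_additive : semi_sigma_additive nu.
Proof.
move=> F mF tF mUF; rewrite /density_measure ge0_integral_bigcup//; last first.
  exact: measurable_funTS.
apply: is_cvg_nneseries => n _ _; exact: integral_ge0.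
Qed.

HB.instance Definition _ := isMeasure.Build _ _ _ nu
  density0 density_ge0 density_sigma_additive.

Let density_fin : fin_num_fun nu.
Proof.
move=> A mA; rewrite ge0_fin_numE ?measure_ge0//.
apply: (@le_lt_trans _ _ (nu setT)); first by apply: le_measure; rewrite ?inE.
exact: integrable_lty.
Qed.

HB.instance Definition _ := @Measure_isFinite.Build _ _ _ nu density_fin.

(** The density measure is dominated by [mu], and its Radon-Nikodym derivative is almost everywhere
    [g] because both have the same integral over every measurable set. *)
Lemma integral_density (phi : T -> \bar R) : (forall x, (0 <= phi x)%E) ->
  measurable_fun setT phi ->
  (\int[nu]_x phi x = \int[mu]_x (phi x * g x))%E.
Proof.
move=> phi0 mphi.
have numu : nu `<< mu.
  apply/null_content_dominatesP => A mA muA0.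
  rewrite -[RHS](integral_abs_eq0 mA (measurable_funTS mg) muA0).
  by apply: eq_integral => x _; rewrite gee0_abs.
rewrite -(Radon_Nikodym_SigmaFinite.change_of_variables numu)//.
have iRN := Radon_Nikodym_SigmaFinite.f_integrable numu.
have mRN := measurable_int _ iRN.
apply: ge0_ae_eq_integral => //.
- exact: emeasurable_funM.
- exact: emeasurable_funM.
- by move=> x _; rewrite mule_ge0// Radon_Nikodym_SigmaFinite.f_ge0.
- by move=> x _; rewrite mule_ge0.
have : ae_eq mu setT (Radon_Nikodym_SigmaFinite.f nu mu) g.
  apply: integral_ae_eq => // E _ mE.
  by rewrite -Radon_Nikodym_SigmaFinite.f_integral.
by apply: filterS => x + _ => ->.
Qed.

End Density.

(** * Quantile functions and the quantile transform *)

Section Quantile.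
Context {R : realType}.
Local Notation mu := (@lebesgue_measure R).
Variable f : R -> \bar R.
Hypotheses (f0 : forall t, (0 <= f t)%E) (mf : measurable_fun setT f)
  (fin : (\int[mu]_(t in `]0%R, +oo[) f t < +oo)%E).

Let F (y : R) : \bar R := (\int[mu]_(t in `]0%R, y]) f t)%E.
Let Q (v : R) : R := inf [set y : R | 0 < y /\ (v%:E <= F y)%E].

Lemma cdf_fin y : F y \is a fin_num.
Proof.
rewrite ge0_fin_numE ?integral_ge0//; apply: le_lt_trans fin.
apply: ge0_subset_integral => //; first exact: measurable_funTS.
by move=> t; rewrite /= !in_itv /= andbT => /andP[].
Qed.

Lemma cdf_le y z : y <= z -> (F y <= F z)%E.
Proof.
move=> yz; apply: ge0_subset_integral => //; first exact: measurable_funTS.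
by move=> t; rewrite /= !in_itv /= => /andP[-> /= ty]; exact: le_trans yz.
Qed.

Lemma cdf_le0 y : y <= 0 -> F y = 0%E.
Proof. by move=> y0; rewrite /F set_itv_ge ?integral_set0// bnd_simp -leNgt. Qed.

Lemma cdf_split y z : 0 <= y -> y <= z ->
  F z = (F y + \int[mu]_(t in `]y, z]) f t)%E.
Proof.
move=> y0 yz; rewrite /F -ge0_integral_setU//.
- by rewrite -itv_bndbnd_setU// bnd_simp.
- exact: measurable_funTS.
- apply/disj_setPS => t [] /=; rewrite !in_itv /= => /andP[_ ty] /andP[yt _].
  by rewrite ltNge ty in yt.
Qed.

(** Right continuity of [F]: the intervals from 0 to [y + 1/(n+1)] decrease to the one ending at
    [y], and a finite measure is continuous from above. *)
Lemma cdf_right_lim (v : \bar R) y : (forall e, 0 < e -> (v <= F (y + e))%E) ->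
  (v <= F y)%E.
Proof.
move=> vF.
pose g : measurableTypeR R -> \bar R := f \_ (`]0, +oo[%classic : set R).
have g0 (t : measurableTypeR R) : (0 <= g t)%E by exact: erestrict_ge0.
have ig : mu.-integrable setT g.
  apply/integrableP; split.
    by apply: (measurable_restrictT _ (measurable_itv _)).1; exact: measurable_funTS.
  under eq_integral do rewrite gee0_abs//.
  by rewrite -integral_mkcond.
have FE z : F z = density_measure g0 ig `]0, z]%classic.
  rewrite /density_measure /F; apply: eq_integral => t.
  by rewrite inE /= in_itv /= /g patchE => /andP[t0 _]; rewrite mem_set//= in_itv /= t0.
pose G n := (`]0, (y + n.+1%:R^-1)%R]%classic : set R).
have GE : \bigcap_n G n = `]0, y]%classic.
  apply/seteqP; split => t /=; rewrite in_itv /=.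
    move=> Gt; have /andP[-> _] : 0 < t <= y + 1%:R^-1 by have := Gt 0%N I; rewrite /G /= in_itv.
    rewrite leNgt; apply/negP => yt.
    have ty : 0 < t - y by rewrite subr_gt0.
    have [n _ /(_ _ (leqnn n)) /=] := near_infty_natSinv_lt (PosNum ty).
    rewrite ltrBrDl ltNge => /negP; apply.
    by have := Gt n I; rewrite /G /= in_itv /= => /andP[].
  move=> /andP[t0 ty] n _; rewrite /G /= in_itv /= t0 (le_trans ty)//.
  by rewrite lerDl invr_ge0.
have GF : (density_measure g0 ig \o G) n @[n --> \oo] --> F y.
  rewrite FE -GE; apply: nonincreasing_cvg_mu => //.
  - suff : (F (y + 1%:R^-1) < +oo)%E by rewrite FE.
    by rewrite ltey_eq cdf_fin.
  - by move=> n; exact: measurable_itv.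
  - by rewrite GE; exact: measurable_itv.
  - move=> m n mn; apply/subsetPset => t; rewrite /G /= !in_itv /= => /andP[-> /= tn].
    by rewrite (le_trans tn)// lerD2l lef_pV2 ?posrE// ler_nat.
rewrite -(cvg_lim (@ereal_hausdorff R) GF); apply: lime_ge; first by apply/cvg_ex; exists (F y).
apply: nearW => n /=; suff : (v <= F (y + n.+1%:R^-1))%E by rewrite FE.
by apply: vF; rewrite invr_gt0.
Qed.

(** The Galois connection between [Q] and [F]. Right continuity makes the infimum attained, and
    [0 < v] excludes nonpositive [y], where [F] vanishes. *)
Lemma quantile_le v y : 0 < v -> (exists2 z, 0 < z & (v%:E <= F z)%E) ->
  (Q v <= y) = (v%:E <= F y)%E.
Proof.
move=> v0 [z z0 vz].
have Qinf : has_inf [set y : R | 0 < y /\ (v%:E <= F y)%E].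
  by split; [exists z|exists 0 => t /= [/ltW]].
apply/idP/idP => [Qy|vy].
  apply: cdf_right_lim => e e0.
  have [t [t0 vt] tQ] := inf_adherent e0 Qinf.
  by apply: le_trans vt _; apply: cdf_le; rewrite (le_trans (ltW tQ))// lerD2r.
apply: ge_inf; first exact: Qinf.2.
split => //; rewrite ltNge; apply/negP => y0.
by move: vy; rewrite cdf_le0// lee_fin leNgt v0.
Qed.

(** Positivity of [f] near [x] gives every [y < x] a strictly smaller value of [F], so no smaller
    point reaches the level [F x]. *)
Lemma quantile_cdf (x : R) : 0 < x ->
  (\forall t \near x, (0 < f t)%E) -> Q (fine (F x)) = x.
Proof.
move=> x0 /nbhs_ballP[e /= e0 eP].
have lt y : 0 <= y -> y < x -> (F y < F x)%E.
  move=> y0 yx; rewrite (cdf_split y0 (ltW yx)) -[ltLHS]adde0 lteD2lE ?cdf_fin//.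
  (* A point strictly between [y] and [x] that also lies in the ball where [f] is positive. *)
  pose c := (Num.max y (x - e) + x) / 2.
  have mx : Num.max y (x - e) < x by rewrite gt_max yx ltrBlDr ltrDl.
  have [] := midf_lt mx; rewrite -/c gt_max => /andP[yc xec] cx.
  apply: (@integral_gt0_near _ _ _ c) => //; first exact: measurable_funTS.
  near=> t; split.
    rewrite /= in_itv /=; apply/andP; split.
      by near: t; exact: lt_nbhsr.
    by apply: ltW; near: t; exact: lt_nbhsl.
  apply: eP; rewrite /ball /= ltr_distlC; apply/andP; split.
    by near: t; exact: lt_nbhsr.
  apply: (@lt_trans _ _ x); last by rewrite ltrDl.
  by near: t; exact: lt_nbhsl.
have v0 : 0 < fine (F x).
  by rewrite -lte_fin fineK ?cdf_fin// -[ltLHS](cdf_le0 (lexx 0)) lt.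
have xP : exists2 z, 0 < z & ((fine (F x))%:E <= F z)%E.
  by exists x => //; rewrite fineK ?cdf_fin.
apply/eqP; rewrite eq_le quantile_le// fineK ?cdf_fin// lexx /=.
rewrite leNgt; apply/negP => Qx.
have Q0 : 0 <= Q (fine (F x)).
  by apply: lb_le_inf; [exists x; split => //; rewrite fineK ?cdf_fin|move=> t [/ltW]].
have := lt _ Q0 Qx; rewrite ltNge => /negP; apply.
by rewrite -[leLHS]fineK ?cdf_fin// -quantile_le.
Unshelve. all: by end_near. Qed.

(** Both sides integrate [phi] against one measure: Lebesgue measure up to the level [F x], pushed
    forward along the quantile function, is the measure with density [f] up to [x]. The two are
    compared on open rays by [quantile_le]. *)
Lemma quantile_change_of_variables (x : R) (phi : R -> \bar R) :
  0 < x -> (0 < F x)%E ->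
  (forall t, (0 <= phi t)%E) -> measurable_fun setT phi ->
  (\int[mu]_(v in `]0%R, fine (F x)]) phi (Q v) =
   \int[mu]_(t in `]0%R, x]) (phi t * f t))%E.
Proof.
move=> x0 Fx0 phi0 mphi; set u := fine (F x).
have uE : u%:E = F x by rewrite fineK ?cdf_fin.
have u0 : 0 < u by rewrite -lte_fin uE.
pose g : measurableTypeR R -> \bar R := f \_ (`]0, x]%classic : set R).
have g0 (t : measurableTypeR R) : (0 <= g t)%E by exact: erestrict_ge0.
have ig : mu.-integrable setT g.
  apply/integrableP; split.
    by apply: (measurable_restrictT _ (measurable_itv _)).1; exact: measurable_funTS.
  under eq_integral do rewrite gee0_abs//.
  by rewrite -integral_mkcond -ge0_fin_numE ?cdf_fin// integral_ge0.
pose h : measurableTypeR R -> \bar R := (cst 1%E) \_ (`]0, u]%classic : set R).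
have h0 (t : measurableTypeR R) : (0 <= h t)%E by apply: erestrict_ge0.
have ih : mu.-integrable setT h.
  apply/integrableP; split.
    by apply: (measurable_restrictT _ (measurable_itv _)).1; exact: measurable_cst.
  under eq_integral do rewrite gee0_abs//.
  rewrite -integral_mkcond integral_cst// mul1e /= lebesgue_measure_itv/=.
  by case: ifP => // _; rewrite ltry.
have uP v : v <= u -> exists2 z, 0 < z & (v%:E <= F z)%E.
  by move=> vu; exists x => //; rewrite -uE lee_fin.
(* For a level that is never reached the set is empty, and its infimum is the default 0. *)
have Q_ge0 v : 0 <= Q v.
  have [S0|/set0P S0] := eqVneq [set y : R | 0 < y /\ (v%:E <= F y)%E] set0.
    by rewrite /Q S0 inf0.
  by apply: lb_le_inf => // t [/ltW].
(* Clamping the level to at most [u] keeps it attained, so [Q'] is nondecreasing on the whole line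
   and hence measurable. It equals [Q] at the levels that are integrated over. *)
pose Q' (v : measurableTypeR R) : measurableTypeR R :=
  if v <= 0 then 0 else Q (Num.min v u).
have Q'E v : 0 < v <= u -> Q' v = Q v.
  by move=> /andP[v0 vu]; rewrite /Q' leNgt v0 /= (min_idPl vu).
have mQ : measurable_fun setT Q'.
  apply: nondecreasing_measurable => // v w vw; rewrite /Q'.
  case: (leP v 0) => v0; first by case: ifP.
  have w0 := lt_le_trans v0 vw; rewrite [w <= 0]leNgt w0 /=.
  have mv0 : 0 < Num.min v u by rewrite lt_min v0.
  have mw0 : 0 < Num.min w u by rewrite lt_min (lt_le_trans v0 vw).
  rewrite quantile_le//; last by apply: uP; rewrite ge_min lexx orbT.
  apply: (@le_trans _ _ (Num.min w u)%:E).
    by rewrite lee_fin le_min !ge_min vw lexx orbT.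
  by rewrite -quantile_le//; apply: uP; rewrite ge_min lexx orbT.
transitivity (\int[pushforward (density_measure h0 ih) Q']_t phi t)%E.
  rewrite ge0_integral_pushforward// preimage_setT integral_density//=; last first.
    exact: measurableT_comp.
  rewrite integral_mkcond; apply: eq_integral => v _; rewrite /h !patchE.
  case: ifPn => [|_]; last by rewrite mule0.
  by rewrite inE /= in_itv /= => vu; rewrite mule1 Q'E.
transitivity (\int[density_measure g0 ig]_t phi t)%E; last first.
  rewrite integral_density// [RHS]integral_mkcond; apply: eq_integral => t _.
  by rewrite /g !patchE; case: ifPn => // _; rewrite mule0.
apply: eq_measure_integral => A mA _.
(* Open rays generate the Borel sets and are stable under intersection, so two measures that agree
   and are finite on them coincide. *)
apply: (@measure_unique _ _ (measurableTypeR R) (@RGenOInfty.G R)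
  (fun n => `]- n%:R, +oo[%classic)) => //.
- exact: RGenOInfty.measurableE.
- move=> _ _ [y ->] [z ->]; exists (Num.max y z); apply/seteqP; split => t /=;
    by rewrite !in_itv /= !andbT gt_max => /andP.
- by move=> n; exists (- n%:R).
- apply/seteqP; split => // t _; exists (Num.truncn `|t|).+1 => //=.
  rewrite in_itv /= andbT ltrNl (le_lt_trans (ler_norm _))// normrN.
  exact: truncnS_gt.
- move=> _ [y ->].
  pose y' := Num.max y 0.
  have FyE : F y' = F y.
    by rewrite /y'; case: (leP y 0) => // y0; rewrite !cdf_le0.
  have Fy0 : (0 <= F y)%E by exact: integral_ge0.
  rewrite /= /pushforward /density_measure /h /g -!integral_mkcondr /=.
  (* By the Galois connection, [y < Q v] means [F y < v]; the pushed measure of the ray is thus the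
     length [u - F y], or 0 when this interval is empty. *)
  rewrite (_ : _ `&` _ = `]fine (F y), u]%classic); last first.
    apply/seteqP; split => v /=; rewrite !in_itv /= ?andbT.
      move=> [yv /[dup] vu /andP[v0 vu']]; rewrite vu' andbT.
      move: yv; rewrite Q'E// ltNge quantile_le//; last exact: uP.
      by rewrite -ltNge -[ltLHS]fineK ?cdf_fin// lte_fin.
    move=> /andP[yv vu].
    have v0 : 0 < v by apply: le_lt_trans yv; exact: fine_ge0.
    rewrite v0 vu Q'E ?v0 ?vu//; split => //; rewrite ltNge quantile_le//; last exact: uP.
    by rewrite -ltNge -[ltLHS]fineK ?cdf_fin// lte_fin.
  rewrite (_ : _ `&` _ = `]y', x]%classic); last first.
    apply/seteqP; split => v /=; rewrite !in_itv /= gt_max ?andbT.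
      by move=> [-> /andP[-> ->]].
    by move=> /andP[/andP[-> ->] ->].
  rewrite integral_cst// mul1e /= lebesgue_measure_itv /= lte_fin.
  have [xy|yx] := leP x y'.
    rewrite set_itv_ge ?integral_set0 ?bnd_simp -?leNgt// ltNge.
    by rewrite fine_le ?cdf_fin// -FyE cdf_le.
  have y'0 : 0 <= y' by rewrite /y' le_max lexx orbT.
  have := cdf_split y'0 (ltW yx); rewrite FyE -uE.
  set I := (\int[mu]_(t in `]y', x]) f t)%E => uI.
  have I0 : (0 <= I)%E by exact: integral_ge0.
  have IE : I = (u - fine (F y))%:E.
    by rewrite EFinB uI fineK ?cdf_fin// addeC addeA [(_ + F y)%E]addeC subee ?cdf_fin// add0e.
  rewrite IE lee_fin subr_ge0 in I0 *; rewrite le_eqVlt in I0.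
  by case/orP: I0 => [/eqP ->|->//]; rewrite ltxx subrr.
- move=> n; rewrite -ge0_fin_numE ?measure_ge0//.
  by apply: fin_num_measure => //; exact: measurable_itv.
Qed.

End Quantile.

(** * Conditional distributions and pair copulas *)

Section ConditionalDistributions.
Context {R : realType} {d : nat}.
Local Notation mu := (@lebesgue_measure R).
Variable r : 'rV[R]_d -> R.
Hypotheses (rc : {within orthant, continuous r}) (r0 : forall x, orthant x -> 0 <= r x).
Implicit Types (x y : 'rV[R]_d) (J D : {set 'I_d}).

Local Notation m := (emargin r).

Section OneVariable.
Variables (a : 'I_d) (J : {set 'I_d}) (x : 'rV[R]_d) (c : R).
Hypotheses (aJ : a \notin J) (x0 : orthant x) (c0 : 0 < c) (mJ : m J x = c%:E).

Lemma cond_densityE t : 0 < t ->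
  cond_density r [set a]%SET J (upd x a t) = (m (a |: J)%SET (upd x a t) * (c^-1)%:E)%E.
Proof.
move=> t0; rewrite /cond_density !marginE; try exact: orthant_upd.
by rewrite (emargin_upd _ _ _ aJ) mJ inver gt_eqF.
Qed.

Let f t := (m (a |: J)%SET (upd x a t) * (c^-1)%:E)%E.

Let f0 t : (0 <= f t)%E.
Proof. by rewrite mule_ge0 ?emargin_ge0// lee_fin invr_ge0 ltW. Qed.

Let mf : measurable_fun setT f.
Proof. by apply: emeasurable_funM => //; exact: measurable_emargin_upd. Qed.

Let f1 : (\int[mu]_(t in `]0%R, +oo[) f t = 1)%E.
Proof.
rewrite ge0_integralZr//.
- by rewrite -emargin_integrate_out// mJ -EFinM mulfV ?gt_eqF.
- exact: measurable_emargin_upd.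
- by move=> t _; exact: emargin_ge0.
- by rewrite lee_fin invr_ge0 ltW.
Qed.

Let ffin : (\int[mu]_(t in `]0%R, +oo[) f t < +oo)%E.
Proof. by rewrite f1 ltry. Qed.

Lemma cond_cdfE (y : R) : cond_cdf r a J y x = (\int[mu]_(t in `]0%R, y]) f t)%E.
Proof.
apply: eq_integral => t; rewrite inE /= in_itv /= => /andP[t0 _].
exact: cond_densityE.
Qed.

Lemma cond_quantileE u : cond_quantile r a J u x =
  inf [set y : R | 0 < y /\ (u%:E <= \int[mu]_(t in `]0%R, y]) f t)%E].
Proof.
by congr inf; apply/seteqP; split => y /= [y0]; rewrite cond_cdfE.
Qed.

Lemma cond_cdf_fin (y : R) : cond_cdf r a J y x \is a fin_num.
Proof. by rewrite cond_cdfE cdf_fin. Qed.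

Let near_f : (0 < m (a |: J)%SET x)%E -> \forall t \near x 0 a, (0 < f t)%E.
Proof.
move=> /(lower_semicontinuous_emargin rc r0)[V xV Vm].
have := near_upd_coord a xV; apply: filterS => t /Vm mt.
by rewrite mule_gt0// lte_fin invr_gt0.
Qed.

Lemma cond_quantile_cdf : (0 < m (a |: J)%SET x)%E ->
  cond_quantile r a J (fine (cond_cdf r a J (x 0 a)%R x)) x = x 0 a.
Proof.
move=> ma; rewrite cond_quantileE cond_cdfE.
by rewrite quantile_cdf//; exact: near_f.
Qed.

Lemma cond_cdf_gt0 : (0 < m (a |: J)%SET x)%E -> (0 < cond_cdf r a J (x 0 a)%R x)%E.
Proof.
move=> ma; rewrite cond_cdfE.
have xa := x0 a; have mid : 0 < x 0 a / 2 by rewrite divr_gt0.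
have [e /= e0 eP] := (@nbhs_ballP _ _ _ _).1 (near_f ma).
pose z := Num.max 0 (x 0 a - e).
have zx : z < x 0 a by rewrite gt_max xa ltrBlDr ltrDl.
have [zt tx] := midf_lt zx; set t := (z + x 0 a) / 2 in zt tx.
move: zt; rewrite gt_max => /andP[t0 te].
apply: (@integral_gt0_near _ _ _ t) => //; first exact: measurable_funTS.
near=> s; split.
  rewrite /= in_itv /=; apply/andP; split.
    by near: s; exact: lt_nbhsr.
  by apply: ltW; near: s; exact: lt_nbhsl.
apply: eP; rewrite /ball /= ltr_distlC; apply/andP; split.
  by near: s; exact: lt_nbhsr.
apply: (@lt_trans _ _ (x 0 a)%R); last by rewrite ltrDl.
by near: s; exact: lt_nbhsl.
Unshelve. all: by end_near. Qed.

(** Positivity near the coordinate leaves some mass to its right. Strictness matters because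
    equality of the pair copulas is assumed only at levels inside the open unit interval. *)
Lemma cond_cdf_lt1 : (0 < m (a |: J)%SET x)%E -> (cond_cdf r a J (x 0 a)%R x < 1)%E.
Proof.
move=> ma; rewrite cond_cdfE -f1.
have itvU : `]0, +oo[%classic = `]0, x 0 a] `|` `]x 0 a, +oo[ :> set R.
  by rewrite -itv_bndbnd_setU// bnd_simp ltW.
rewrite itvU ge0_integral_setU//; last 2 first.
  exact: measurable_funTS.
  apply/disj_setPS => t [] /=; rewrite !in_itv /= andbT => /andP[_ tx] xt.
  by rewrite ltNge tx in xt.
rewrite -[ltLHS]adde0 lteD2lE ?cdf_fin//.
have [e /= e0 eP] := (@nbhs_ballP _ _ _ _).1 (near_f ma).
have xe : x 0 a < x 0 a + e by rewrite ltrDl.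
have [xt te] := midf_lt xe; set t := (x 0 a + (x 0 a + e)) / 2 in xt te.
apply: (@integral_gt0_near _ _ _ t) => //; first exact: measurable_funTS.
near=> s; have xs : x 0 a < s by near: s; exact: lt_nbhsr.
split; first by rewrite /= in_itv /= xs.
apply: eP; rewrite /ball /= ltr_distlC; apply/andP; split.
  by rewrite (lt_trans _ xs)// gtrBl.
by near: s; exact: lt_nbhsl.
Unshelve. all: by end_near. Qed.

(** This keeps the point at which the pair copula density is evaluated inside the orthant. *)
Lemma cond_quantile_gt0 v : 0 < v -> (v%:E <= cond_cdf r a J (x 0 a)%R x)%E ->
  0 < cond_quantile r a J v x.
Proof.
move=> v0; rewrite cond_cdfE => vx; rewrite cond_quantileE ltNge quantile_le//.
  by rewrite cdf_le0// lee_fin -ltNge.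
by exists (x 0 a)%R.
Qed.

Lemma cond_quantile_change_of_variables (phi : R -> \bar R) :
  (0 < m (a |: J)%SET x)%E ->
  (forall t, (0 <= phi t)%E) -> measurable_fun setT phi ->
  (\int[mu]_(v in `]0%R, fine (cond_cdf r a J (x 0 a)%R x)])
     phi (cond_quantile r a J v x) =
   \int[mu]_(t in `]0%R, (x 0 a)%R]) (phi t * f t))%E.
Proof.
move=> ma phi0 mphi; have Fx0 := cond_cdf_gt0 ma; rewrite cond_cdfE in Fx0 *.
apply: (etrans _ (quantile_change_of_variables f0 mf ffin (x0 a) Fx0 phi0 mphi)).
by apply: eq_integral => v _; rewrite cond_quantileE.
Qed.

End OneVariable.

(* The pair copula density in the coordinates x_a, x_b *)
Definition copula_of_margins a b D y : R :=
  let rab := m (a |: (b |: D))%SET y in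
  let ra := m (a |: D)%SET y in
  let rb := m (b |: D)%SET y in
  if [&& rab \is a fin_num, ra \is a fin_num, rb \is a fin_num
       & (ra * rb != 0)%E]
  then fine rab * fine (m D y) / (fine ra * fine rb) else 0.

(** Each conditional density is a margin divided by the positive constant [r_D (x_D)]. This division
    changes neither the finiteness nor the nonvanishing tests, and one factor [r_D] survives in the
    quotient. *)
Lemma pair_copula_densityE a b D u v x :
  a \notin D -> b \notin D -> orthant x ->
  (0 < m D x < +oo)%E ->
  0 < cond_quantile r a D u x -> 0 < cond_quantile r b D v x ->
  pair_copula_density r a b D u v x = copula_of_margins a b D
    (upd (upd x a (cond_quantile r a D u x)) b (cond_quantile r b D v x)).
Proof.
move=> aD bD x0 /andP[mD0 mDoo] qa qb; rewrite /pair_copula_density.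
set y := upd (upd x a _) b _.
have y0 : orthant y by apply: orthant_upd => //; exact: orthant_upd.
have mDE : m D y = m D x by rewrite !emargin_upd.
have [c mDc] : exists c, m D x = c%:E.
  by exists (fine (m D x)); rewrite fineK// ge0_fin_numE// ltW.
have c0 : 0 < c by rewrite -lte_fin -mDc.
have E I : cond_density r I D y = (m (I :|: D)%SET y * (c^-1)%:E)%E.
  by rewrite /cond_density !marginE// mDE mDc inver gt_eqF.
have Efin z : (0 <= z)%E -> (z * (c^-1)%:E \is a fin_num)%E = (z \is a fin_num).
  case: z => [z _| _|//]; first by rewrite -EFinM.
  by rewrite gt0_mulye// lte_fin invr_gt0.
have Efine z : fine (z * (c^-1)%:E) = fine z / c.
  case: z => [z| |]//=; rewrite ?mul0r.
    by rewrite gt0_mulye// lte_fin invr_gt0.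
  by rewrite gt0_mulNye// lte_fin invr_gt0.
rewrite !E !Efin ?emargin_ge0// !Efine /copula_of_margins mDE mDc /=.
rewrite -(finset.setUA [set a]%SET [set b]%SET D).
set rab := m _ y; set ra := m _ y; set rb := m _ y.
case: (boolP (rab \is a fin_num)) => //= fab.
case: (boolP (ra \is a fin_num)) => //= fa.
case: (boolP (rb \is a fin_num)) => //= fb.
have cN : c != 0 by rewrite gt_eqF.
rewrite !mule_eq0 !eqe !invr_eq0 (negPf cN) !orbF.
case: ifP => // /norP[ra0 rb0].
have fra : fine ra != 0 by rewrite -eqe fineK.
have frb : fine rb != 0 by rewrite -eqe fineK.
by field; rewrite cN fra frb.
Qed.

Lemma copula_of_margins_ge0 a b D y : 0 <= copula_of_margins a b D y.
Proof.
rewrite /copula_of_margins; case: ifP => // _.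
by rewrite divr_ge0// mulr_ge0// fine_ge0// emargin_ge0.
Qed.

Lemma measurable_copula_of_margins a b D x k :
  measurable_fun setT (fun t : R => copula_of_margins a b D (upd x k t)).
Proof.
have mm J : measurable_fun setT (fun t : R => m J (upd x k t)).
  exact: measurable_emargin_upd.
have mfin J : measurable_fun setT (fun t : R => m J (upd x k t) \is a fin_num).
  apply: (eq_measurable_fun (fun t => ~~ (+oo <= m J (upd x k t))%E)) => [t _|].
    by rewrite -ltNge ge0_fin_numE// emargin_ge0.
  by apply: measurable_neg; exact: measurable_fun_lee.
apply: measurable_fun_ifT => //.
  do 3!apply: measurable_and => //.
  apply: (eq_measurable_fun (fun t =>
    ~~ (m (a |: D)%SET (upd x k t) * m (b |: D)%SET (upd x k t) <= 0)%E)).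
    move=> t _; rewrite -ltNge lt_def mule_ge0 ?andbT ?emargin_ge0//.
  apply: measurable_neg; apply: measurable_fun_lee => //.
  exact: emeasurable_funM.
have mfine J : measurable_fun setT (fun t : R => fine (m J (upd x k t))).
  exact: measurableT_comp.
apply: measurable_funM; first exact: measurable_funM.
pose den t := fine (m (a |: D)%SET (upd x k t)) * fine (m (b |: D)%SET (upd x k t)).
(* The inverse is written as a power with exponent -1, which is legitimate because the denominator
   is nonnegative, and the power function is measurable. *)
apply: (eq_measurable_fun ((@powR R ^~ (-1)) \o den)) => [t _|].
  by rewrite /= powR_inv1// mulr_ge0// fine_ge0// emargin_ge0.
apply: measurableT_comp; first exact: measurable_powR.
exact: measurable_funM.
Qed.

Lemma cond_cdf_pair_copula a b D x :
  a \notin D -> b \notin D -> a != b -> orthant x ->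
  (0 < m D x < +oo)%E -> (0 < m (a |: D)%SET x < +oo)%E ->
  (0 < m (b |: D)%SET x < +oo)%E ->
  cond_cdf r a (b |: D)%SET (x 0 a)%R x =
  pair_cond_cdf_l r a b D (fine (cond_cdf r a D (x 0 a)%R x))
    (fine (cond_cdf r b D (x 0 b)%R x)) x.
Proof.
move=> aD bD ab x0 mD /andP[ma0 mafin] /andP[mb0 mbfin].
have [c mDc] : exists c, m D x = c%:E.
  by case/andP: mD => *; exists (fine (m D x)); rewrite fineK// ge0_fin_numE// ltW.
have c0 : 0 < c by rewrite -lte_fin -mDc; case/andP: mD.
have [cb mbc] : exists cb, m (b |: D)%SET x = cb%:E.
  by exists (fine (m (b |: D)%SET x)); rewrite fineK// ge0_fin_numE// ltW.
have cb0 : 0 < cb by rewrite -lte_fin -mbc.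
have abD : a \notin (b |: D)%SET by rewrite !inE negb_or ab.
have baD : b \notin (a |: D)%SET by rewrite !inE negb_or eq_sym ab.
rewrite (cond_cdfE abD x0 cb0 mbc) /pair_cond_cdf_l.
set ua := fine _; set ub := fine _.
(* The quantile of [ub] gives back the coordinate [b] of [x], so only the coordinate [a] moves
   inside the integral. *)
have qb : cond_quantile r b D ub x = x 0 b by exact: (cond_quantile_cdf bD x0 c0 mDc).
have -> : (\int[mu]_(v in `]0%R, ua]) (pair_copula_density r a b D v ub x)%:E =
    \int[mu]_(v in `]0%R, ua])
      (copula_of_margins a b D (upd x a (cond_quantile r a D v x)))%:E)%E.
  apply: eq_integral => v; rewrite inE /= in_itv /= => /andP[v0 vu].
  have qv : 0 < cond_quantile r a D v x.
    apply: (cond_quantile_gt0 aD x0 c0 mDc) => //.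
    by rewrite -[leRHS]fineK ?lee_fin// (cond_cdf_fin aD x0 c0 mDc).
  have qb0 : 0 < cond_quantile r b D ub x by rewrite qb; exact: x0.
  rewrite (pair_copula_densityE aD bD x0 mD qv qb0) qb.
  congr (copula_of_margins _ _ _ _)%:E.
  by rewrite -[RHS](upd_id _ b) upd_neq// eq_sym.
rewrite (cond_quantile_change_of_variables aD x0 c0 mDc ma0
  (phi := fun t => (copula_of_margins a b D (upd x a t))%:E)); last 2 first.
  by move=> t; rewrite lee_fin copula_of_margins_ge0.
  by apply/measurable_EFinP; exact: measurable_copula_of_margins.
have abDE : (a |: (b |: D) = b |: (a |: D))%SET by rewrite finset.setUCA.
apply: ge0_ae_eq_integral => //.
- by apply: emeasurable_funM => //; exact: measurable_emargin_upd.
- apply: emeasurable_funM; last first.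
    by apply: emeasurable_funM => //; exact: measurable_emargin_upd.
  apply/measurable_EFinP; apply: measurable_funTS; exact: measurable_copula_of_margins.
- by move=> t _; rewrite mule_ge0 ?emargin_ge0// lee_fin invr_ge0 ltW.
- move=> t _; rewrite mule_ge0 ?lee_fin ?copula_of_margins_ge0//.
  by rewrite mule_ge0 ?emargin_ge0// lee_fin invr_ge0 ltW.
(* The integrands are compared at the almost all [t] where the margins on [a |: D] and on
   [a |: (b |: D)] are finite. *)
have maoo := emargin_ae_fin rc r0 aD (andP mD).2.
have maboo := emargin_ae_fin rc r0 abD mbfin.
move: maoo maboo; apply: (@filterS2 _ _ (ae_filter_ringOfSetsType mu)) => t ta tab /=.
rewrite in_itv /= => /andP[t0 _]; have {ta} ta := ta t0; have {tab} tab := tab t0.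
have mbt : m (b |: D)%SET (upd x a t) = cb%:E by rewrite emargin_upd.
have xt0 : orthant (upd x a t) by exact: orthant_upd.
rewrite /copula_of_margins mbt (emargin_upd _ _ _ aD) mDc.
have fab : m (a |: (b |: D))%SET (upd x a t) \is a fin_num.
  by rewrite ge0_fin_numE// emargin_ge0.
have fa : m (a |: D)%SET (upd x a t) \is a fin_num.
  by rewrite ge0_fin_numE// emargin_ge0.
have [ma|ma] := eqVneq (m (a |: D)%SET (upd x a t)) 0%E.
  by rewrite ma abDE (emargin_eq0 rc r0 xt0 baD ma) !mul0e mule0.
move: fab fa ma; case: (m _ _) => [p| |]// _; case: (m _ _) => [q| |]// _.
rewrite eqe => qN; have cbN : cb != 0 by rewrite gt_eqF.
have cN : c != 0 by rewrite gt_eqF.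
rewrite mule_eq0 !eqe (negPf qN) (negPf cbN) /= -!EFinM; congr _%:E.
by field; rewrite cN cbN qN.
Qed.

(** With this symmetry the second conditional identity follows from the first by exchanging [a] and
    [b]. *)
Lemma pair_copula_density_sym a b D u v x : a != b ->
  pair_copula_density r a b D u v x = pair_copula_density r b a D v u x.
Proof.
move=> ab; rewrite /pair_copula_density.
move: (cond_quantile r a D u x) (cond_quantile r b D v x) => p q /=.
rewrite (updC _ _ _ ab); move: (upd (upd x b q) a p) => y.
rewrite [[set a; b]%SET]finset.setUC; move: (cond_density r _ D y) => rab.
move: (cond_density r [set a]%SET D y) (cond_density r [set b]%SET D y) => ra rb.
by rewrite muleC [fine ra * _]mulrC [in LHS](andbCA (ra \is a fin_num)).
Qed.

End ConditionalDistributions.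

(** * Uniqueness *)

Section AlmostEverywhereCoordinates.
Context {R : realType} {d : nat}.
Implicit Types (x y : 'rV[R]_d) (s : seq 'I_d) (P Q : 'rV[R]_d -> Prop).
Local Notation mu := (@lebesgue_measure R).

(** An iterated almost-everywhere quantifier over the positive values of the coordinates in [s], the
    head being outermost. It plays the part of a product null set and matches the nesting of
    [foldr integrate_out]. *)
Fixpoint ae_coords s P x : Prop :=
  if s is k :: s' then {ae mu, forall t, 0 < t -> ae_coords s' P (upd x k t)}
  else P x.

Lemma ae_coords_all s P x : (forall y, orthant y -> P y) -> orthant x ->
  ae_coords s P x.
Proof.
move=> PT; elim: s x => [|k s IH] x x0 /=; first exact: PT.
by apply: (@filterE _ _ (ae_filter_ringOfSetsType mu)) => t t0; apply: IH; exact: orthant_upd.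
Qed.

Lemma ae_coords_sub s P Q x : (forall y, orthant y -> P y -> Q y) -> orthant x ->
  ae_coords s P x -> ae_coords s Q x.
Proof.
move=> PQ; elim: s x => [|k s IH] x x0 /=; first exact: PQ.
apply: (@filterS _ _ (ae_filter_ringOfSetsType mu)) => t Pt t0.
by apply: IH (Pt t0); exact: orthant_upd.
Qed.

Lemma ae_coords_and s P Q x : ae_coords s P x -> ae_coords s Q x ->
  ae_coords s (fun y => P y /\ Q y) x.
Proof.
elim: s x => [|k s IH] x //=.
apply: (@filterS2 _ _ (ae_filter_ringOfSetsType mu)) => t Pt Qt t0.
by apply: IH; [exact: Pt|exact: Qt].
Qed.

Lemma ae_coords_cat s1 s2 P x :
  ae_coords (s1 ++ s2) P x = ae_coords s1 (ae_coords s2 P) x.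
Proof.
elim: s1 x => //= k s IH x.
by congr (almost_everywhere mu _); apply/funext => t; rewrite IH.
Qed.

(** At each level a nonnegative function has integral zero exactly when it vanishes almost
    everywhere. This turns iterated quantifiers into iterated integrals, to which Tonelli
    applies. *)
Lemma ae_coords_integral s (g : 'rV[R]_d -> \bar R) x :
  (forall y, (0 <= g y)%E) -> vmeasurable g ->
  ae_coords s (fun y => g y = 0%E) x <-> foldr integrate_out g s x = 0%E.
Proof.
move=> g0 mg; elim: s x => [//|k s IH] x /=.
have h0 := foldr_integrate_out_ge0 s g0.
have mh : measurable_fun (`]0, +oo[%classic : set R)
    (fun t : R => foldr integrate_out g s (upd x k t)).
  by apply: measurable_funTS; apply: measurable_upd; exact: vmeasurable_foldr.
have := ae_eq_integral_abs mu (measurable_itv _) mh.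
rewrite (_ : (\int[mu]_(t in `]0%R, +oo[) _)%E =
  integrate_out k (foldr integrate_out g s) x); last first.
  by apply: eq_integral => t _; rewrite gee0_abs.
move=> [i1 i2]; split=> H.
  apply: i2; move: H; apply: (@filterS _ _ (ae_filter_ringOfSetsType mu)) => t Ht.
  by rewrite /= in_itv /= andbT => /Ht /IH.
move: (i1 H); apply: (@filterS _ _ (ae_filter_ringOfSetsType mu)) => t Ht t0.
by apply/IH; apply: Ht; rewrite /= in_itv /= t0.
Qed.

(** Apply the integral criterion to the indicator [i] of the set where [g] and [h] differ; its
    iterated integral is independent of the order. *)
Lemma ae_coords_perm_eq s1 s2 (g h : 'rV[R]_d -> \bar R) x :
  vmeasurable g -> vmeasurable h -> perm_eq s1 s2 ->
  ae_coords s1 (fun y => g y = h y) x -> ae_coords s2 (fun y => g y = h y) x.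
Proof.
move=> mg mh s12.
pose i y : \bar R := if g y == h y then 0%E else 1%E.
have i0 y : (0 <= i y)%E by rewrite /i; case: ifP.
have mi : vmeasurable i.
  by apply: measurable_fun_ifT => //; exact: measurable_fun_eqe.
have iE : (fun y => g y = h y) = (fun y => i y = 0%E).
  apply/funext => y; apply/propext; rewrite /i.
  by case: eqP => // ghy; split => // -[] /eqP; rewrite oner_eq0.
rewrite iE => /(ae_coords_integral _ _ i0 mi) H; apply/(ae_coords_integral _ _ i0 mi).
by rewrite -(foldr_integrate_out_perm i0 mi s12).
Qed.

End AlmostEverywhereCoordinates.

(** * Recovering a margin from its pair copula *)

Section AlmostEverywhereMargins.
Context {R : realType} {d : nat}.
Implicit Types (x y z : 'rV[R]_d) (D J : {set 'I_d}).
Local Notation mu := (@lebesgue_measure R).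

Lemma emargin_ae_coords_fin (r : 'rV[R]_d -> R) J s x :
  {within orthant, continuous r} -> (forall x, orthant x -> 0 <= r x) ->
  uniq s -> {in s, forall k, k \notin J} -> (emargin r J x < +oo)%E ->
  ae_coords s (fun y => emargin r (J :|: [set k in s])%SET y < +oo)%E x.
Proof.
move=> rc r0; elim: s J x => [|k s IH] J x /=.
  by rewrite (_ : [set k in [::]]%SET = finset.set0) ?finset.setU0//;
    apply/finset.setP => i; rewrite !inE.
move=> /andP[ks us] sJ Jfin.
have kJ : k \notin J by apply: sJ; rewrite mem_head.
have := emargin_ae_fin rc r0 kJ Jfin.
apply: (@filterS _ _ (ae_filter_ringOfSetsType mu)) => t tfin t0.
have := IH (k |: J)%SET (upd x k t) us _ (tfin t0).
rewrite (_ : (k |: J :|: [set k in s])%SET = (J :|: [set k0 in k :: s])%SET); last first.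
  by apply/finset.setP => i; rewrite !inE; do ![case: (_ \in _); rewrite ?orbT ?orbF].
apply=> i si; rewrite !inE negb_or sJ ?inE ?si ?orbT// andbT.
by apply: contraNneq ks => <-.
Qed.

Section TwoFunctions.
Variables r r' : 'rV[R]_d -> R.
Hypotheses (rc : {within orthant, continuous r}) (r0 : forall x, orthant x -> 0 <= r x).
Hypotheses (rc' : {within orthant, continuous r'}) (r0' : forall x, orthant x -> 0 <= r' x).
Local Notation m := (emargin r).
Local Notation m' := (emargin r').

(** The factor [c] covers both uses: 1 for integrating out a coordinate, and the inverse of [r_D]
    for a conditional distribution function. *)
Lemma eq_integral_emargin J k x (A : set R) (c : R) : 0 <= c ->
  measurable A -> A `<=` `]0, +oo[%classic ->
  {ae mu, forall t, 0 < t -> m J (upd x k t) = m' J (upd x k t)} ->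
  (\int[mu]_(t in A) (m J (upd x k t) * c%:E) =
   \int[mu]_(t in A) (m' J (upd x k t) * c%:E))%E.
Proof.
move=> c0 mA A0 mm; apply: ge0_ae_eq_integral => //.
- by apply: emeasurable_funM => //; exact: (measurable_emargin_upd rc r0).
- by apply: emeasurable_funM => //; exact: (measurable_emargin_upd rc' r0').
- by move=> t _; rewrite mule_ge0// (emargin_ge0 r0).
- by move=> t _; rewrite mule_ge0// (emargin_ge0 r0').
- move: mm; apply: (@filterS _ _ (ae_filter_ringOfSetsType mu)) => t mt /A0.
  by rewrite /= in_itv /= andbT => /mt ->.
Qed.

Lemma eq_emargin_integrate_out J k x : k \notin J ->
  {ae mu, forall t, 0 < t ->
    m (k |: J)%SET (upd x k t) = m' (k |: J)%SET (upd x k t)} -> m J x = m' J x.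
Proof.
move=> kJ /(eq_integral_emargin ler01 (measurable_itv `]0, +oo[)) => /(_ (@subset_refl _ _)).
rewrite (emargin_integrate_out rc r0 _ kJ) (emargin_integrate_out rc' r0' _ kJ).
by under eq_integral do rewrite mule1; under [RHS]eq_integral do rewrite mule1.
Qed.

Variables (a b : 'I_d) (D : {set 'I_d}).
Hypotheses (aD : a \notin D) (bD : b \notin D) (ab : a != b).
Hypothesis copula_eq : forall x : 'rV[R]_d, orthant x ->
  (0 < margin r D x < +oo)%E -> (0 < margin r' D x < +oo)%E ->
  forall u v : R, 0 < u < 1 -> 0 < v < 1 ->
    pair_copula_density r a b D u v x = pair_copula_density r' a b D u v x.

Let abD : a \notin (b |: D)%SET. Proof. by rewrite !inE negb_or ab. Qed.
Let baD : b \notin (a |: D)%SET. Proof. by rewrite !inE negb_or eq_sym ab. Qed.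
Let abDE : (a |: (b |: D) = b |: (a |: D))%SET. Proof. exact: finset.setUCA. Qed.

Lemma eq_cond_cdf k z (y c : R) : k \notin D -> orthant z -> 0 < c ->
  m D z = c%:E -> m' D z = c%:E ->
  {ae mu, forall t, 0 < t ->
    m (k |: D)%SET (upd z k t) = m' (k |: D)%SET (upd z k t)} ->
  cond_cdf r k D y z = cond_cdf r' k D y z.
Proof.
move=> kD z0 c0 mD mD' mm.
rewrite (cond_cdfE kD z0 c0 mD) (cond_cdfE kD z0 c0 mD').
apply: eq_integral_emargin mm => //; first by rewrite invr_ge0 ltW.
by move=> t /=; rewrite !in_itv /= => /andP[->].
Qed.

(** Agreement of the lower margins along the two coordinate lines gives both densities the same
    levels [u] and [v] at [z], and both pairs of quantiles return to [z]. The equal copula densities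
    are then the two margins times the same nonzero factor, which cancels. *)
Lemma eq_emargin_pair z :
  orthant z -> (0 < m D z < +oo)%E -> m D z = m' D z ->
  (0 < m (a |: D)%SET z < +oo)%E -> m (a |: D)%SET z = m' (a |: D)%SET z ->
  (0 < m (b |: D)%SET z < +oo)%E -> m (b |: D)%SET z = m' (b |: D)%SET z ->
  (m (a |: (b |: D))%SET z < +oo)%E -> (m' (a |: (b |: D))%SET z < +oo)%E ->
  {ae mu, forall t, 0 < t ->
    m (a |: D)%SET (upd z a t) = m' (a |: D)%SET (upd z a t)} ->
  {ae mu, forall t, 0 < t ->
    m (b |: D)%SET (upd z b t) = m' (b |: D)%SET (upd z b t)} ->
  m (a |: (b |: D))%SET z = m' (a |: (b |: D))%SET z.
Proof.
move=> z0 mD mDE ma maE mb mbE fab fab' aea aeb.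
have [c mDc] : exists c, m D z = c%:E.
  by case/andP: mD => *; exists (fine (m D z)); rewrite fineK// ge0_fin_numE// ltW.
have c0 : 0 < c by rewrite -lte_fin -mDc; case/andP: mD.
have mDc' : m' D z = c%:E by rewrite -mDE.
have mD' : (0 < m' D z < +oo)%E by rewrite -mDE.
case/andP: (ma) => ma0 mafin; case/andP: (mb) => mb0 mbfin.
have ma0' : (0 < m' (a |: D)%SET z)%E by rewrite -maE.
have mb0' : (0 < m' (b |: D)%SET z)%E by rewrite -mbE.
pose u := fine (cond_cdf r a D (z 0 a) z); pose v := fine (cond_cdf r b D (z 0 b) z).
have uE : u = fine (cond_cdf r' a D (z 0 a) z).
  by rewrite /u (eq_cond_cdf _ aD z0 c0 mDc mDc' aea).
have vE : v = fine (cond_cdf r' b D (z 0 b) z).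
  by rewrite /v (eq_cond_cdf _ bD z0 c0 mDc mDc' aeb).
have u01 : 0 < u < 1.
  rewrite -!lte_fin /u fineK ?(cond_cdf_fin rc r0 aD z0 c0 mDc)//.
  by rewrite (cond_cdf_gt0 rc r0 aD z0 c0 mDc)// (cond_cdf_lt1 rc r0 aD z0 c0 mDc).
have v01 : 0 < v < 1.
  rewrite -!lte_fin /v fineK ?(cond_cdf_fin rc r0 bD z0 c0 mDc)//.
  by rewrite (cond_cdf_gt0 rc r0 bD z0 c0 mDc)// (cond_cdf_lt1 rc r0 bD z0 c0 mDc).
have qa : cond_quantile r a D u z = z 0 a by exact: (cond_quantile_cdf rc r0 aD z0 c0 mDc).
have qb : cond_quantile r b D v z = z 0 b by exact: (cond_quantile_cdf rc r0 bD z0 c0 mDc).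
have qa' : cond_quantile r' a D u z = z 0 a.
  by rewrite uE; exact: (cond_quantile_cdf rc' r0' aD z0 c0 mDc').
have qb' : cond_quantile r' b D v z = z 0 b.
  by rewrite vE; exact: (cond_quantile_cdf rc' r0' bD z0 c0 mDc').
have := copula_eq z0; rewrite !marginE// => /(_ mD mD' u v u01 v01).
rewrite (pair_copula_densityE r0) ?qa ?qb//.
rewrite (pair_copula_densityE r0') ?qa' ?qb'//.
rewrite !upd_id /copula_of_margins -maE -mbE mDc mDc'.
have fE (q : \bar R) : (0 <= q)%E -> (q < +oo)%E -> q \is a fin_num.
  by move=> ?; rewrite ge0_fin_numE.
move: (fE _ (emargin_ge0 r0 _ _) fab) (fE _ (emargin_ge0 r0' _ _) fab').
move: (fE _ (ltW ma0) mafin) (fE _ (ltW mb0) mbfin) (ma0) (mb0).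
case: (m (a |: D)%SET z) => [p| |]// _; case: (m (b |: D)%SET z) => [q| |]// _.
rewrite !lte_fin => p0 q0.
case: (m _ z) => [w| |]// _; case: (m' _ z) => [w'| |]// _.
rewrite mule_eq0 !eqe !gt_eqF//= => wE; congr _%:E.
have pqc : c / (p * q) != 0 by rewrite gt_eqF// divr_gt0// mulr_gt0.
by apply: (mulIf pqc); rewrite !mulrA.
Qed.

Lemma ae_eq_emargin_pair y : orthant y ->
  (m D y < +oo)%E -> (m' D y < +oo)%E ->
  {ae mu, forall t, 0 < t ->
    m (a |: D)%SET (upd y a t) = m' (a |: D)%SET (upd y a t)} ->
  {ae mu, forall t, 0 < t ->
    m (b |: D)%SET (upd y b t) = m' (b |: D)%SET (upd y b t)} ->
  ae_coords [:: a; b]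
    (fun z => m (a |: (b |: D))%SET z = m' (a |: (b |: D))%SET z) y.
Proof.
move=> y0 mD mD' aea aeb /=.
(* Integrating out [a] turns the almost-everywhere agreement into equality at [y]. Wherever a lower
   margin is zero it is zero for both functions, and so are both larger margins; the remaining case
   is [eq_emargin_pair]. *)
have mDE := eq_emargin_integrate_out aD aea.
have [mD0|mDN] := eqVneq (m D y) 0%E.
  apply: (@filterE _ _ (ae_filter_ringOfSetsType mu)) => t t0.
  apply: (@filterE _ _ (ae_filter_ringOfSetsType mu)) => s s0.
  have z0 : orthant (upd (upd y a t) b s) by apply: orthant_upd => //; exact: orthant_upd.
  have mbz : m (b |: D)%SET (upd (upd y a t) b s) = 0%E.
    by apply: (emargin_eq0 rc r0 z0 bD); rewrite !emargin_upd.
  have mbz' : m' (b |: D)%SET (upd (upd y a t) b s) = 0%E.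
    by apply: (emargin_eq0 rc' r0' z0 bD); rewrite !emargin_upd// -mDE.
  by rewrite (emargin_eq0 rc r0 z0 abD mbz) (emargin_eq0 rc' r0' z0 abD mbz').
have mDpos : (0 < m D y < +oo)%E by rewrite mD andbT lt_def mDN (emargin_ge0 r0).
move: aea (emargin_ae_fin rc r0 aD mD).
move=> /[dup] aea; apply: (@filterS2 _ _ (ae_filter_ringOfSetsType mu)) => t ta tfin t0.
have {}ta := ta t0; have {}tfin := tfin t0.
have yt0 : orthant (upd y a t) by exact: orthant_upd.
have [ma0|maN] := eqVneq (m (a |: D)%SET (upd y a t)) 0%E.
  apply: (@filterE _ _ (ae_filter_ringOfSetsType mu)) => s s0.
  have z0 : orthant (upd (upd y a t) b s) by exact: orthant_upd.
  have maz : m (a |: D)%SET (upd (upd y a t) b s) = 0%E by rewrite emargin_upd.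
  have maz' : m' (a |: D)%SET (upd (upd y a t) b s) = 0%E by rewrite emargin_upd// -ta.
  by rewrite abDE (emargin_eq0 rc r0 z0 baD maz) (emargin_eq0 rc' r0' z0 baD maz').
have tfin' : (m' (a |: D)%SET (upd y a t) < +oo)%E by rewrite -ta.
have abfin : {ae mu, forall s, 0 < s ->
    (m (b |: (a |: D))%SET (upd (upd y a t) b s) < +oo)%E /\
    (m' (b |: (a |: D))%SET (upd (upd y a t) b s) < +oo)%E}.
  move: (emargin_ae_fin rc r0 baD tfin) (emargin_ae_fin rc' r0' baD tfin').
  apply: (@filterS2 _ _ (ae_filter_ringOfSetsType mu)) => s h h' s0.
  by split; [exact: h|exact: h'].
move: (aeb) (emargin_ae_fin rc r0 bD mD) abfin.
apply: (@filterS3 _ _ (ae_filter_ringOfSetsType mu)) => s sb sfin sab s0.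
have {}sb := sb s0; have {}sfin := sfin s0; have {sab} [sab sab'] := sab s0.
set z := upd (upd y a t) b s; have z0 : orthant z by exact: orthant_upd.
have zb : z = upd (upd y b s) a t by rewrite /z updC.
have mbz : m (b |: D)%SET z = m (b |: D)%SET (upd y b s) by rewrite zb emargin_upd.
have mbz' : m' (b |: D)%SET z = m (b |: D)%SET (upd y b s).
  by rewrite zb emargin_upd// sb.
have maz : m (a |: D)%SET z = m (a |: D)%SET (upd y a t) by rewrite /z emargin_upd.
have maz' : m' (a |: D)%SET z = m (a |: D)%SET (upd y a t) by rewrite /z emargin_upd// ta.
have mDz : m D z = m D y by rewrite /z !emargin_upd.
have mDz' : m' D z = m D y by rewrite /z !emargin_upd.
have [mb0|mbN] := eqVneq (m (b |: D)%SET (upd y b s)) 0%E.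
  rewrite -mbz in mb0; rewrite (emargin_eq0 rc r0 z0 abD mb0).
  by rewrite mbz -mbz' in mb0; rewrite (emargin_eq0 rc' r0' z0 abD mb0).
rewrite -abDE in sab sab'.
apply: eq_emargin_pair => //.
- by rewrite mDz.
- by rewrite mDz mDz'.
- by rewrite maz tfin andbT lt_def maN (emargin_ge0 r0).
- by rewrite maz maz'.
- by rewrite mbz sfin andbT lt_def mbN (emargin_ge0 r0).
- by rewrite mbz mbz'.
(* The hypothesis at [y] holds at [z] as well, since the margin on [a |: D] ignores the coordinate
   [b]. *)
- move: (aea); apply: (@filterS _ _ (ae_filter_ringOfSetsType mu)) => t' + t'0 => /(_ t'0).
  have -> : upd z a t' = upd (upd y a t') b s by rewrite zb upd_upd (updC _ _ _ ab).
  by rewrite !(emargin_upd _ _ _ baD).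
- move: (aeb); apply: (@filterS _ _ (ae_filter_ringOfSetsType mu)) => s' + s'0 => /(_ s'0).
  have -> : upd z b s' = upd (upd y b s') a t by rewrite /z upd_upd (updC _ _ _ ab).
  by rewrite !(emargin_upd _ _ _ abD).
Qed.

End TwoFunctions.

End AlmostEverywhereMargins.

(** * Induction along the vine and uniqueness *)

Section TailCopulaUniqueness.
Context {R : realType} {d : nat}.
Implicit Types (x y : 'rV[R]_d) (D : {set 'I_d}) (r : 'rV[R]_d -> R).

Lemma emargin_set1 r (j : 'I_d) x : tail_copula_density r -> orthant x ->
  emargin r [set j]%SET x = 1%E.
Proof. by move=> [_ _ r1 _] x0; rewrite -marginE// r1. Qed.

(** This ordering quantifies over [D] first and over [a] last, so a statement about [a |: D] can be
    read slice by slice at fixed coordinates in [D]. *)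
Lemma perm_enum_setU1 (a j : 'I_d) D : j \in D -> a \notin D ->
  perm_eq (enum (a |: D)%SET) ((j :: enum (D :\ j)%SET) ++ [:: a]).
Proof.
move=> jD aD; apply: uniq_perm; first exact: enum_uniq.
  rewrite cat_uniq /= enum_uniq mem_enum !inE eqxx orbF mem_enum !inE /= andbT.
  rewrite (negPf aD) andbF orbF.
  by apply: contraNneq aD => ->.
move=> i; rewrite mem_cat mem_enum !inE mem_enum !inE.
by have [->|] := eqVneq i j; rewrite ?jD ?orbT//= orbC.
Qed.

(** The univariate margin at [j] is 1, hence finite; adding the other coordinates of [D] one by one
    keeps finiteness almost everywhere. *)
Lemma ae_coords_fin r D j x : tail_copula_density r -> orthant x -> j \in D ->
  ae_coords (j :: enum (D :\ j)%SET) (fun y => emargin r D y < +oo)%E x.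
Proof.
move=> tr x0 jD; have [rc r0 _ _] := tr.
apply: (@filterE _ _ (ae_filter_ringOfSetsType lebesgue_measure)) => t t0.
have xt0 : orthant (upd x j t) by exact: orthant_upd.
have DE : ([set j] :|: [set k in enum (D :\ j)%SET])%SET = D.
  apply/finset.setP => i; rewrite !inE mem_enum !inE.
  by have [->|] := eqVneq i j.
have := @emargin_ae_coords_fin _ _ r [set j]%SET (enum (D :\ j)%SET) (upd x j t)
  rc r0 (enum_uniq _).
rewrite DE; apply; last by rewrite emargin_set1// ltry.
by move=> i; rewrite mem_enum !inE => /andP[].
Qed.

Lemma ae_coords_vine_step r r' (a b : 'I_d) D :
  tail_copula_density r -> tail_copula_density r' ->
  a \notin D -> b \notin D -> a != b -> D != finset.set0 ->
  (forall x, orthant x ->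
    (0 < margin r D x < +oo)%E -> (0 < margin r' D x < +oo)%E ->
    forall u v : R, 0 < u < 1 -> 0 < v < 1 ->
      pair_copula_density r a b D u v x = pair_copula_density r' a b D u v x) ->
  (forall x, orthant x -> ae_coords (enum (a |: D)%SET)
    (fun y => emargin r (a |: D)%SET y = emargin r' (a |: D)%SET y) x) ->
  (forall x, orthant x -> ae_coords (enum (b |: D)%SET)
    (fun y => emargin r (b |: D)%SET y = emargin r' (b |: D)%SET y) x) ->
  forall x, orthant x -> ae_coords (enum (a |: (b |: D))%SET)
    (fun y => emargin r (a |: (b |: D))%SET y = emargin r' (a |: (b |: D))%SET y) x.
Proof.
move=> tr tr' aD bD ab /set0Pn[j jD] cop Ha Hb x x0.
have [rc r0 _ _] := tr; have [rc' r0' _ _] := tr'.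
have mm J := vmeasurable_emargin rc r0 J; have mm' J := vmeasurable_emargin rc' r0' J.
pose s := j :: enum (D :\ j)%SET.
have {Ha} Ha := ae_coords_perm_eq (mm _) (mm' _) (perm_enum_setU1 jD aD) (Ha x x0).
have {Hb} Hb := ae_coords_perm_eq (mm _) (mm' _) (perm_enum_setU1 jD bD) (Hb x x0).
have sab : perm_eq (s ++ [:: a; b]) (enum (a |: (b |: D))%SET).
  rewrite perm_sym; have abD : a \notin (b |: D)%SET by rewrite !inE negb_or ab.
  apply: (@perm_trans _ (a :: enum (b |: D)%SET)).
    apply: uniq_perm; rewrite ?enum_uniq//= ?mem_enum ?abD ?enum_uniq//.
    by move=> i; rewrite mem_enum in_cons mem_enum !inE.
  rewrite -[a :: _]cat1s -[[:: a; b]]cat1s perm_sym perm_catCA perm_sym perm_cat2l.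
  exact: perm_enum_setU1.
apply: (ae_coords_perm_eq (mm _) (mm' _) sab); rewrite ae_coords_cat.
rewrite ae_coords_cat in Ha; rewrite ae_coords_cat in Hb.
have H := ae_coords_and (ae_coords_and Ha Hb)
  (ae_coords_and (ae_coords_fin tr x0 jD) (ae_coords_fin tr' x0 jD)).
apply: ae_coords_sub x0 H => y y0 [[ya yb] [yfin yfin']].
exact: (ae_eq_emargin_pair rc r0 rc' r0' aD bD ab cop).
Qed.

Lemma emargin_setT r x : emargin r finset.setT x = ext0 r x.
Proof.
rewrite /emargin; have -> : enum (~: [set: 'I_d])%SET = [::]; last by [].
by apply/size0nil; rewrite -cardE finset.setCT cards0.
Qed.

(** The continuous function [h], the distance of [r] and [r'], has iterated integral zero; were it
    positive at one point of the orthant, this integral would be positive. *)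
Lemma tail_copula_density_ae_eq r r' :
  {within orthant, continuous r} -> {within orthant, continuous r'} ->
  (forall x, orthant x -> ae_coords (enum 'I_d)
    (fun y => ext0 r y = ext0 r' y) x) ->
  forall x, orthant x -> r x = r' x.
Proof.
move=> rc rc' ae x x0; apply/eqP; rewrite -subr_eq0 -normr_eq0; apply/negPn/negP => rx.
pose h y := `|r y - r' y|.
have hc : {within orthant, continuous h}.
  by move=> y; apply: cvg_norm; apply: cvgB; [exact: rc|exact: rc'].
have h0 y : orthant y -> 0 <= h y by rewrite /h.
have H : ae_coords (enum 'I_d) (fun y => ext0 h y = 0%E) x.
  apply: ae_coords_sub x0 (ae x x0) => y y0.
  by rewrite !ext0_orthant// /h => -[->]; rewrite subrr normr0.
have g0 := ext0_ge0 h0; have lg := lower_semicontinuous_ext0 hc h0.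
have /(ae_coords_integral _ _ g0 (lower_semicontinuous_vmeasurable lg)) I0 := H.
have := foldr_integrate_out_gt0 (enum 'I_d) g0 lg x0.
rewrite I0 ltxx ext0_orthant// lte_fin /h lt_def rx normr_ge0 => /(_ isT).
by [].
Qed.

Lemma ae_coords_vine r r' (V : vine_edges d) : regular_vine V ->
  tail_copula_density r -> tail_copula_density r' ->
  (forall e : {set 'I_d}, e \in V 0%N ->
     forall x : 'rV[R]_d, orthant x -> margin r e x = margin r' e x) ->
  (forall (j : nat) (a b : 'I_d) (D : {set 'I_d}),
     (j.+1 < d.-1)%N -> is_vine_edge V j a b D ->
     forall x : 'rV[R]_d, orthant x ->
       (0 < margin r D x < +oo)%E -> (0 < margin r' D x < +oo)%E ->
     forall u v : R, 0 < u < 1 -> 0 < v < 1 ->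
       pair_copula_density r a b D u v x = pair_copula_density r' a b D u v x) ->
  forall j (e : {set vnode d j}), (j < d.-1)%N -> e \in V j ->
  forall x, orthant x -> ae_coords (enum (complete_union e))
    (fun y => emargin r (complete_union e) y = emargin r' (complete_union e) y) x.
Proof.
move=> hV tr tr' biv cop; elim=> [|j IH] e jd eV x x0.
  by apply: ae_coords_all x0 => y y0; rewrite -!marginE//; exact: biv.
have [f [g [a [b [D [[eE [fV gV]] fE gE -> [edge aD bD ab D0]]]]]]] := vine_edge_split hV jd eV.
apply: (ae_coords_vine_step tr tr' aD bD ab D0 (cop j a b D jd edge) _ _ x0) => y y0.
- by rewrite -fE; exact: (IH f (ltnW jd) fV y y0).
- by rewrite -gE; exact: (IH g (ltnW jd) gV y y0).
Qed.

End TailCopulaUniqueness.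

Theorem theorem5p2 (R : realType) (d : nat) (V : vine_edges d)
    (hd : (3 <= d)%N) (hV : regular_vine V) :
  (forall r : 'rV[R]_d -> R, tail_copula_density r ->
   forall (j : nat) (a b : 'I_d) (D : {set 'I_d}),
     (j.+1 < d.-1)%N -> is_vine_edge V j a b D ->
   forall x : 'rV[R]_d, orthant x ->
     (0 < margin r D x < +oo)%E ->
     (0 < margin r (a |: D)%SET x < +oo)%E ->
     (0 < margin r (b |: D)%SET x < +oo)%E ->
     let ua := fine (cond_cdf r a D (x 0 a) x) in
     let ub := fine (cond_cdf r b D (x 0 b) x) in
     cond_cdf r a (b |: D)%SET (x 0 a) x = pair_cond_cdf_l r a b D ua ub x /\
     cond_cdf r b (a |: D)%SET (x 0 b) x = pair_cond_cdf_r r a b D ub ua x)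
  /\
  (forall r r' : 'rV[R]_d -> R,
     tail_copula_density r -> tail_copula_density r' ->
     (forall e : {set 'I_d}, e \in V 0%N ->
        forall x : 'rV[R]_d, orthant x -> margin r e x = margin r' e x) ->
     (forall (j : nat) (a b : 'I_d) (D : {set 'I_d}),
        (j.+1 < d.-1)%N -> is_vine_edge V j a b D ->
        forall x : 'rV[R]_d, orthant x ->
          (0 < margin r D x < +oo)%E -> (0 < margin r' D x < +oo)%E ->
        forall u v : R, 0 < u < 1 -> 0 < v < 1 ->
          pair_copula_density r a b D u v x =
          pair_copula_density r' a b D u v x) ->
     forall x : 'rV[R]_d, orthant x -> r x = r' x).
Proof.
split=> [r [rc r0 _ _] j a b D _ [f [g [_ DE symdiff ltab]]] x x0|
    r r' tr tr' biv cop x x0].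
  rewrite !marginE// => mD ma mb ua ub.
  have ab : a != b by apply: contraTneq ltab => ->; rewrite ltnn.
  have nD i : i \in [set a; b]%SET -> i \notin D.
    by rewrite -symdiff DE !inE; case: (i \in complete_union f); case: (i \in complete_union g).
  have aD : a \notin D by apply: nD; rewrite !inE eqxx.
  have bD : b \notin D by apply: nD; rewrite !inE eqxx orbT.
  split; first exact: cond_cdf_pair_copula.
  have ba : b != a by rewrite eq_sym.
  apply: (etrans (cond_cdf_pair_copula rc r0 bD aD ba x0 mD mb ma)).
  by apply: eq_integral => v _; rewrite (pair_copula_density_sym _ _ _ _ _ ba).
have [rc _ _ _] := tr; have [rc' _ _ _] := tr'.
have d1 : (1 < d)%N by exact: ltnW.
have dd : (d.-2 < d.-1)%N by case: (d) d1 => [|[]].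
have d2 : d.-2.+2 = d by case: (d) d1 => [|[]].
(* The last tree has index [d.-2], and the complete union of its edge has [d.-2.+2] elements, that
   is [d]. *)
have [e eV] := top_edge hV d1.
have eT : complete_union e = [set: 'I_d]%SET.
  apply/eqP; rewrite finset.eqEcard finset.subsetT cardsT card_ord.
  by rewrite (card_complete_union hV dd eV) d2 leqnn.
apply: tail_copula_density_ae_eq x0 => // y y0.
have := ae_coords_vine hV tr tr' biv cop dd eV y0; rewrite eT.
rewrite (_ : enum [set: 'I_d]%SET = enum 'I_d); last first.
  by apply: eq_enum => i; rewrite !inE.
by apply: ae_coords_sub y0 => z _; rewrite !emargin_setT.
Qed.
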